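(* Let $k$ be an algebraically closed field of characteristic zero, let $W$ be a semisimple weak Hopf algebra over $k$ with Haar integral $h$, and let $A$ be a $W$-module algebra with invariant subalgebra $B = A^W$. Let $\rho : A \to A \otimes_k W^*$, $\rho(a) = a_{(0)} \otimes a_{(1)}$, be the corresponding right $W^*$-comodule algebra structure on $A$, determined by $w \cdot a = a_{(0)} \langle a_{(1)}, w\rangle$ for all $w \in W$, $a \in A$. Then the Galois mapping $$\beta : A \otimes_B A \to (A \otimes W^* )\rho(1_A), \qquad \beta(x \otimes y) = x y_{(0)} \otimes y_{(1)},$$ is an isomorphism if and only if the canonical mapping $$\pi : A \# W \to \operatorname{End} A_B, \qquad \pi(a \# w)(x) = a (w \cdot x) \quad (x \in A),$$ is an algebra isomorphism and the right $B$-module $A_B$ is finite projective.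
   Context: A weak bialgebra $W$ is a finite dimensional $k$-algebra and $k$-coalgebra $(W,\Delta,\varepsilon)$ with $\Delta$ linear and multiplicative, $\varepsilon$ linear, satisfying $$1_{(1)} \otimes 1_{(2)} \otimes 1_{(3)} = (\Delta(1) \otimes 1)(1 \otimes \Delta(1)) = (1 \otimes \Delta(1))(\Delta(1) \otimes 1),$$ $$\varepsilon(abc) = \varepsilon(ab_{(1)})\varepsilon(b_{(2)}c) = \varepsilon(ab_{(2)})\varepsilon(b_{(1)}c) \quad (a,b,c \in W).$$ ($\Delta$ and $\varepsilon$ need not be unital, nor $\varepsilon$ multiplicative.) Put $\Pi^L(x) = \varepsilon(1_{(1)}x)1_{(2)}$, $\Pi^R(x) = 1_{(1)}\varepsilon(x1_{(2)})$, and $W^L = \operatorname{Im} \Pi^L$. A weak Hopf algebra is a weak bialgebra with an antipode, a linear map $S : W \to W$ with $$S(x_{(1)})x_{(2)} = \Pi^R(x), \quad x_{(1)}S(x_{(2)}) = \Pi^L(x), \quad S(x_{(1)})x_{(2)}S(x_{(3)}) = S(x)$$ for all $x \in W$; $S$ is bijective with inverse denoted $\overline{S}$. The dual $W^*$ is again a weak Hopf algebra. A Haar integral in $W$ is an element $h \in W$ with $ah = \Pi^L(a)h$ and $ha = h\Pi^R(a)$ for all $a \in W$, and $\Pi^L(h) = 1 = \Pi^R(h)$. A $W$-module algebra is an algebra $A$ that is a (left) $W$-module with $w \cdot (ab) = (w_{(1)} \cdot a)(w_{(2)} \cdot b)$ and $w \cdot 1 = \Pi^L(w) \cdot 1$ for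 all $w \in W$, $a,b \in A$. Its invariant subalgebra is $A^W = \{ b \in A : w \cdot b = \Pi^L(w) \cdot b \text{ for all } w \in W \}$. A right $W^*$-comodule algebra is an algebra $A$ with a right coaction $\rho : A \to A \otimes W^*$ such that $\rho(ab) = \rho(a)\rho(b)$ in the tensor product algebra and $\rho(1) = 1_{(0)} \otimes \Pi^L(1_{(1)})$ ($\Pi^L$ that of $W^*$). Left $W$-module algebra structures correspond to right $W^*$-comodule algebra structures via $w \cdot a = a_{(0)}\langle a_{(1)}, w\rangle$. The smash product algebra $A \# W$ is the vector space $A \otimes_{W^L} W$, where $W^L$ acts on $W$ by left multiplication and on $A$ from the right by $a \cdot w^L = \overline{S}(w^L) \cdot a = a(w^L \cdot 1)$ for $w^L \in W^L$; writing $a \# w$ for $a \otimes w \in A \otimes_{W^L} W$, its multiplication is $(a \# w)(b \# v) = a(w_{(1)} \cdot b) \# w_{(2)}v$, with unit $1_A \# 1_W$. *)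

(* Defs.v *)
From HB Require Import structures.
From mathcomp Require Import all_boot all_order all_algebra all_field.
From mathcomp Require Import boolp.

Set Implicit Arguments.
Unset Strict Implicit.
Unset Printing Implicit Defensive.

Import GRing.Theory.
Local Open Scope ring_scope.
Local Open Scope quotient_scope.

(* [tensor r l] is the k-module with generators m (x) n, for m : M and n : N,
   subject to k-bilinearity and to (m.i) (x) n = m (x) (i.n), where the index
   i : I acts on M by [r i] and on N by [l i].  Elements are classes of finite
   formal sums; scalars are absorbed in the left factor, and the factor c in
   [te_bal] makes the balancing relations stable under them. *)
Section Tensor.
Variables (k : fieldType) (M N : lmodType k) (I : Type).
Variables (r : I -> M -> M) (l : I -> N -> N).

Inductive tens_eq : seq (M * N) -> seq (M * N) -> Prop :=
| te_refl s : tens_eq s s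
| te_sym s t : tens_eq s t -> tens_eq t s
| te_trans s t u : tens_eq s t -> tens_eq t u -> tens_eq s u
| te_perm s t : perm_eq s t -> tens_eq s t
| te_cat s t u : tens_eq s t -> tens_eq (s ++ u) (t ++ u)
| te_Dl m m' n : tens_eq [:: (m + m', n)] [:: (m, n); (m', n)]
| te_Dr m n n' : tens_eq [:: (m, n + n')] [:: (m, n); (m, n')]
| te_Z c m n : tens_eq [:: (c *: m, n)] [:: (m, c *: n)]
| te_0 n : tens_eq [:: (0, n)] [::]
| te_bal i c m n : tens_eq [:: (c *: r i m, n)] [:: (c *: m, l i n)].

Definition tens_rel (s t : seq (M * N)) : bool := `[< tens_eq s t >].

Lemma tens_rel_refl : reflexive tens_rel.
Proof. by move=> s; apply/asboolP; exact: te_refl. Qed.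
Lemma tens_rel_sym : symmetric tens_rel.
Proof. by move=> s t; apply/asboolP/asboolP; exact: te_sym. Qed.
Lemma tens_rel_trans : transitive tens_rel.
Proof.
by move=> t s u /asboolP st /asboolP tu; apply/asboolP; exact: te_trans tu.
Qed.

Canonical tens_equiv :=
  EquivRel tens_rel tens_rel_refl tens_rel_sym tens_rel_trans.

Definition tensor : Type := {eq_quot tens_equiv}.
HB.instance Definition _ := Choice.on tensor.
HB.instance Definition _ := EqQuotient.on tensor.

Definition tclass (s : seq (M * N)) : tensor := \pi_tensor s.

Lemma tclassE s t : tens_eq s t -> tclass s = tclass t.
Proof. by move=> st; apply/eqquotP/asboolP. Qed.

Lemma tens_reprE s : tens_eq (repr (tclass s)) s.
Proof. by apply/asboolP; have /eqquotP := reprK (tclass s). Qed.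

Lemma tclassK (v : tensor) : tclass (repr v) = v.
Proof. exact: reprK. Qed.

Lemma tclassP (v : tensor) : exists s, v = tclass s.
Proof. by exists (repr v); rewrite tclassK. Qed.

Opaque tclass.

Definition tadd (s t : tensor) : tensor := tclass (repr s ++ repr t).
Definition tzero : tensor := tclass [::].
Definition tscale (c : k) (s : tensor) : tensor :=
  tclass [seq (c *: p.1, p.2) | p <- repr s].
Definition topp (s : tensor) : tensor := tscale (-1) s.

Lemma te_cat2 s s' t t' :
  tens_eq s s' -> tens_eq t t' -> tens_eq (s ++ t) (s' ++ t').
Proof.
move=> /te_cat ss' /te_cat tt'; apply: te_trans (ss' t) _.
apply: te_trans (te_perm _) _; first by rewrite perm_catC.
apply: te_trans (tt' s') (te_perm _); by rewrite perm_catC.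
Qed.

Lemma tadd_pi s t : tadd (tclass s) (tclass t) = tclass (s ++ t).
Proof. by apply: tclassE; apply: te_cat2; exact: tens_reprE. Qed.

Lemma te_scale c s t : tens_eq s t ->
  tens_eq [seq (c *: p.1, p.2) | p <- s] [seq (c *: p.1, p.2) | p <- t].
Proof.
elim=> {s t} /=.
- by move=> s; exact: te_refl.
- by move=> s t _; exact: te_sym.
- by move=> s t u _ st _; exact: te_trans.
- by move=> s t st; apply/te_perm/perm_map.
- by move=> s t u _ st; rewrite !map_cat; exact: te_cat.
- by move=> m m' n; rewrite scalerDr; exact: te_Dl.
- by move=> m n n'; exact: te_Dr.
- by move=> d m n; rewrite scalerA mulrC -scalerA; exact: te_Z.
- by move=> n; rewrite scaler0; exact: te_0.
- by move=> i d m n; rewrite !scalerA; exact: te_bal.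
Qed.

Lemma tscale_pi c s : tscale c (tclass s) = tclass [seq (c *: p.1, p.2) | p <- s].
Proof. by apply: tclassE; apply: te_scale; exact: tens_reprE. Qed.

Opaque tadd tscale.

Lemma taddA : associative tadd.
Proof.
move=> s t u; have [[a ->] [b ->] [c ->]] := And3 (tclassP s) (tclassP t) (tclassP u).
by rewrite !tadd_pi catA.
Qed.
Lemma taddC : commutative tadd.
Proof.
move=> s t; have [[a ->] [b ->]] := conj (tclassP s) (tclassP t).
rewrite !tadd_pi; apply/tclassE/te_perm.
by rewrite perm_catC.
Qed.
Lemma tadd0 : left_id tzero tadd.
Proof. by move=> v; have [s ->] := tclassP v; rewrite tadd_pi. Qed.
Lemma taddN : left_inverse tzero topp tadd.
Proof.
move=> v; have [s ->] := tclassP v.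
rewrite /topp tscale_pi tadd_pi; apply: tclassE.
elim: s => [|[m n] s IHs] /=; first exact: te_refl.
set s' := [seq _ | p <- s] in IHs *.
have /te_perm st : perm_eq ((-1 *: m, n) :: s' ++ (m, n) :: s)
    ([:: (-1 *: m, n); (m, n)] ++ (s' ++ s)).
  by rewrite /= perm_cons -cat1s perm_catCA.
apply: te_trans st (te_trans (te_cat2 (te_refl _) IHs) _).
rewrite cats0 /=; apply: te_trans (te_0 n); apply: te_sym.
rewrite /= -(addNr m) -scaleN1r.
exact: te_Dl.
Qed.

HB.instance Definition _ := GRing.isZmodule.Build tensor taddA taddC tadd0 taddN.

Lemma tclassD s t : tclass s + tclass t = tclass (s ++ t).
Proof. exact: tadd_pi. Qed.

Definition tpure (m : M) (n : N) : tensor := tclass [:: (m, n)].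

Lemma tpi_sum s : tclass s = \sum_(p <- s) tpure p.1 p.2.
Proof.
elim: s => [|[m n] s IHs]; first by rewrite big_nil.
by rewrite big_cons -IHs tclassD.
Qed.

Lemma tpureDl n : {morph tpure^~ n : m m' / m + m'}.
Proof.
move=> m m'; rewrite tclassD; exact/tclassE/te_Dl.
Qed.

Fact tscaleA a b v : tscale a (tscale b v) = tscale (a * b) v.
Proof.
have [s ->] := tclassP v; rewrite !tscale_pi -map_comp.
by congr (tclass _); apply: eq_map => p /=; rewrite scalerA.
Qed.
Fact tscale1 : left_id 1 tscale.
Proof.
move=> v; have [s ->] := tclassP v; rewrite tscale_pi -[in RHS](map_id s).
by congr (tclass _); apply: eq_map => -[m n] /=; rewrite scale1r.
Qed.
Fact tscaleDr : right_distributive tscale +%R.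
Proof.
move=> c s t; have [[a ->] [b ->]] := conj (tclassP s) (tclassP t).
by rewrite tclassD !tscale_pi tclassD map_cat.
Qed.
Fact tscaleDl v : {morph tscale^~ v : a b / a + b}.
Proof.
move=> a b; have [s ->] := tclassP v; rewrite !tscale_pi !tpi_sum !big_map.
by rewrite -big_split; apply: eq_bigr => p _ /=; rewrite scalerDl tpureDl.
Qed.
HB.instance Definition _ := GRing.Zmodule_isLmodule.Build k tensor
  tscaleA tscale1 tscaleDr tscaleDl.

Lemma tpureZl n c m : tpure (c *: m) n = c *: tpure m n.
Proof. by rewrite [RHS]tscale_pi. Qed.
Lemma tpureDr m : {morph tpure m : n n' / n + n'}.
Proof. by move=> n n'; rewrite tclassD; exact/tclassE/te_Dr. Qed.
Lemma tpureZr m c n : tpure m (c *: n) = c *: tpure m n.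
Proof. by rewrite -tpureZl; apply/tclassE/te_sym/te_Z. Qed.
Lemma tpure_bal i m n : tpure (r i m) n = tpure m (l i n).
Proof. by have /tclassE := te_bal i 1 m n; rewrite !scale1r. Qed.

(* [tlift f t] is "f t_1 t_2" in Sweedler style: f is summed over a chosen
   decomposition of t.  The choice is immaterial when f is balanced, see
   [tlift_pure] and [tliftP]. *)
Definition tlift (P : nmodType) (f : M -> N -> P) (t : tensor) : P :=
  \sum_(p <- repr t) f p.1 p.2.

Record balanced (P : lmodType k) (f : M -> N -> P) : Prop := Balanced {
  balanced_l : forall n, linear (f^~ n);
  balanced_r : forall m, linear (f m);
  balanced_m : forall i m n, f (r i m) n = f m (l i n) }.

Lemma tlift_pi (P : lmodType k) (f : M -> N -> P) s : balanced f ->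
  tlift f (tclass s) = \sum_(p <- s) f p.1 p.2.
Proof.
case=> fl fr fb; have := tens_reprE s; rewrite /tlift.
move: (repr _) => t; elim=> {s t} //=.
- by move=> s t u _ -> _.
- by move=> s t st; apply: perm_big.
- by move=> s t u _ st; rewrite !big_cat /= st.
- move=> m m' n; rewrite big_seq1 big_cons big_seq1 /=.
  by have := fl n 1 m m'; rewrite !scale1r.
- move=> m n n'; rewrite big_seq1 big_cons big_seq1 /=.
  by have := fr m 1 n n'; rewrite !scale1r.
- move=> c m n; rewrite !big_seq1 /=.
  by rewrite (scalable_linear (fl n)) (scalable_linear (fr m)).
- move=> n; rewrite big_seq1 big_nil /=.
  by have := fl n (-1) 0 0; rewrite scaler0 addr0 scaleN1r addNr.
move=> i c m n; rewrite !big_seq1 /=.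
by rewrite (scalable_linear (fl n)) [RHS](scalable_linear (fl _)) /= fb.
Qed.

Lemma tlift_pure (P : lmodType k) (f : M -> N -> P) m n : balanced f ->
  tlift f (tpure m n) = f m n.
Proof. by move=> bf; rewrite tlift_pi // big_seq1. Qed.

Lemma tlift_linear (P : lmodType k) (f : M -> N -> P) : balanced f ->
  linear (tlift f).
Proof.
move=> bf c u v; have [[s ->] [t ->]] := conj (tclassP u) (tclassP v).
rewrite [c *: _]tscale_pi tclassD !tlift_pi // big_cat big_map scaler_sumr /=.
by congr (_ + _); apply: eq_bigr => p _; rewrite (scalable_linear (balanced_l bf _)).
Qed.

Lemma tlift_tpure t : tlift tpure t = t.
Proof. by rewrite /tlift -tpi_sum tclassK. Qed.

Lemma tlift_additive (P Q : nmodType) (g : {additive P -> Q}) (f : M -> N -> P) t :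
  g (tlift f t) = tlift (fun x y => g (f x y)) t.
Proof. exact: raddf_sum. Qed.

Lemma tlift_ext (P : nmodType) (f g : M -> N -> P) t :
  (forall x y, f x y = g x y) -> tlift f t = tlift g t.
Proof. by move=> fg; apply: eq_bigr. Qed.

Lemma tliftP (P : lmodType k) (f : M -> N -> P) (g : tensor -> P) :
  linear g -> (forall m n, g (tpure m n) = f m n) -> forall t, g t = tlift f t.
Proof.
move=> lg gf t; pose G := GRing.isLinear.Build _ _ _ _ g lg.
pose g' : {linear tensor -> P} := HB.pack g G.
rewrite -[in LHS](tlift_tpure t) -[g]/(g' : _ -> _) tlift_additive.
exact: tlift_ext.
Qed.

Lemma balanced_pure : balanced tpure.
Proof.
split=> [n c m m'|m c n n'|]; first by rewrite tpureDl tpureZl.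
- by rewrite tpureDr tpureZr.
- exact: tpure_bal.
Qed.
End Tensor.

Notation "\tens_ ( x , y <- t ) F" := (tlift (fun x y => F) t)
  (at level 36, F at level 36, x name, y name, t at level 50,
   format "'[' \tens_ ( x ,  y  <-  t ) '/  '  F ']'") : ring_scope.

Lemma tens_ind (k : fieldType) (M N : lmodType k) I (r : I -> M -> M)
    (l : I -> N -> N) (P : tensor r l -> Prop) :
  P 0 -> (forall m n, P (tpure r l m n)) ->
  (forall s t, P s -> P t -> P (s + t)) -> forall t, P t.
Proof.
by move=> P0 Pp PD t; rewrite -(tlift_tpure t); apply: big_ind => // p _.
Qed.

Lemma tlift_lin (k : fieldType) (M N : lmodType k) I (r : I -> M -> M)
    (l : I -> N -> N) (P : lmodType k) (c : k) (f g : M -> N -> P)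
    (t : tensor r l) :
  \tens_(x, y <- t) (c *: f x y + g x y) =
  c *: (\tens_(x, y <- t) f x y) + \tens_(x, y <- t) g x y.
Proof. by rewrite /tlift big_split scaler_sumr. Qed.

Lemma tlift_comp (k : fieldType) (M N : lmodType k) I (r : I -> M -> M)
    (l : I -> N -> N) (P Q : lmodType k) (g : P -> Q) (f : M -> N -> P)
    (t : tensor r l) :
  linear g -> g (\tens_(x, y <- t) f x y) = \tens_(x, y <- t) g (f x y).
Proof.
move=> lg; pose G := GRing.isLinear.Build _ _ _ _ g lg.
pose g' : {linear P -> Q} := HB.pack g G.
by rewrite -[g]/(g' : _ -> _) tlift_additive.
Qed.

Lemma tlift_exchange (k : fieldType) (M N M' N' : lmodType k) I I'
    (r : I -> M -> M) (l : I -> N -> N) (r' : I' -> M' -> M') (l' : I' -> N' -> N')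
    (P : nmodType) (f : M -> N -> M' -> N' -> P)
    (s : tensor r l) (t : tensor r' l') :
  \tens_(x, y <- s) \tens_(x', y' <- t) f x y x' y' =
  \tens_(x', y' <- t) \tens_(x, y <- s) f x y x' y'.
Proof. exact: exchange_big. Qed.

Definition tensk (k : fieldType) (M N : lmodType k) : Type :=
  tensor (@GRing.scale k M) (@GRing.scale k N).
HB.instance Definition _ (k : fieldType) (M N : lmodType k) :=
  GRing.Lmodule.on (tensk M N).

Definition tpurek (k : fieldType) (M N : lmodType k) : M -> N -> tensk M N :=
  @tpure k M N k *:%R *:%R.
Notation "x \ox y" := (tpurek x y) (at level 40, left associativity) : ring_scope.

Section TensK.
Variables (k : fieldType) (M N : lmodType k).

Definition bilin (P : lmodType k) (f : M -> N -> P) : Prop :=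
  (forall n, linear (f^~ n)) /\ (forall m, linear (f m)).

Lemma bilin_balanced (P : lmodType k) (f : M -> N -> P) :
  bilin f -> balanced (@GRing.scale k M) (@GRing.scale k N) f.
Proof.
case=> fl fr; split=> // c m n.
by rewrite (scalable_linear (fl n)) (scalable_linear (fr m)).
Qed.

Lemma tliftk_pure (P : lmodType k) (f : M -> N -> P) m n :
  bilin f -> \tens_(x, y <- m \ox n) f x y = f m n.
Proof. by move=> /bilin_balanced; exact: tlift_pure. Qed.

Lemma tliftk_linear (P : lmodType k) (f : M -> N -> P) :
  bilin f -> linear (fun t : tensk M N => \tens_(x, y <- t) f x y).
Proof. by move=> /bilin_balanced; exact: tlift_linear. Qed.

Lemma bilin_pure : bilin (@tpurek k M N).
Proof. by case: (balanced_pure (@GRing.scale k M) (@GRing.scale k N)). Qed.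

Lemma oxPl c (m m' : M) (n : N) :
  (c *: m + m') \ox n = c *: (m \ox n) + m' \ox n.
Proof. by case: bilin_pure => + _; apply. Qed.
Lemma oxPr c (m : M) (n n' : N) :
  m \ox (c *: n + n') = c *: (m \ox n) + m \ox n'.
Proof. by case: bilin_pure => _; apply. Qed.
Lemma oxZl c (m : M) (n : N) : (c *: m) \ox n = c *: (m \ox n).
Proof. exact: tpureZl. Qed.
Lemma oxZr c (m : M) (n : N) : m \ox (c *: n) = c *: (m \ox n).
Proof. exact: tpureZr. Qed.
End TensK.

Lemma mulPl (k : fieldType) (A : algType k) (c : k) (a a' b : A) :
  (c *: a + a') * b = c *: (a * b) + a' * b.
Proof. by rewrite mulrDl scalerAl. Qed.
Lemma mulPr (k : fieldType) (A : algType k) (c : k) (b a a' : A) :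
  b * (c *: a + a') = c *: (b * a) + b * a'.
Proof. by rewrite mulrDr scalerAr. Qed.
Lemma scalePl (k : fieldType) (V : lmodType k) (c a b : k) (v : V) :
  (c * a + b) *: v = c *: (a *: v) + b *: v.
Proof. by rewrite scalerDl scalerA. Qed.
Lemma scalePr (k : fieldType) (V : lmodType k) (c a : k) (v v' : V) :
  a *: (c *: v + v') = c *: (a *: v) + a *: v'.
Proof. by rewrite scalerDr !scalerA mulrC. Qed.
Definition linE := (oxPl, oxPr, mulPl, mulPr, scalePl, scalePr).

Section TensAlgebra.
Variables (k : fieldType) (A C : algType k).
Implicit Types s t u : tensk A C.

Definition tensk_mul s t : tensk A C :=
  \tens_(a, c <- s) \tens_(b, d <- t) ((a * b) \ox (c * d)).

Fact tensk_mul_bilinr a c : bilin (fun b d => (a * b) \ox (c * d) : tensk A C).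
Proof.
have [pl pr] := bilin_pure A C.
split=> [d e b b'|b e d d']; rewrite mulrDr -scalerAr; [exact: pl|exact: pr].
Qed.

Fact tensk_mul_bilinl t :
  bilin (fun a c => \tens_(b, d <- t) ((a * b) \ox (c * d)) : tensk A C).
Proof.
have [pl pr] := bilin_pure A C.
split=> [c e a a'|a e c c']; rewrite -tlift_lin; apply: tlift_ext => b d;
  rewrite mulrDl -scalerAl; [exact: pl|exact: pr].
Qed.

Fact tensk_mul_linearl t : linear (tensk_mul^~ t).
Proof. exact/tliftk_linear/tensk_mul_bilinl. Qed.

Fact tensk_mul_linearr s : linear (tensk_mul s).
Proof.
move=> e t u; rewrite /tensk_mul -tlift_lin; apply: tlift_ext => a c.
exact/tliftk_linear/tensk_mul_bilinr.
Qed.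

Fact tensk_mul_pure a c b d :
  tensk_mul (a \ox c) (b \ox d) = (a * b) \ox (c * d).
Proof.
rewrite /tensk_mul tliftk_pure; last exact: tensk_mul_bilinl.
by rewrite tliftk_pure //; exact: tensk_mul_bilinr.
Qed.

Fact tensk_mulDl : left_distributive tensk_mul +%R.
Proof. by move=> s t u; have := tensk_mul_linearl u 1 s t; rewrite !scale1r. Qed.
Fact tensk_mulDr : right_distributive tensk_mul +%R.
Proof. by move=> s t u; have := tensk_mul_linearr s 1 t u; rewrite !scale1r. Qed.
Fact tensk_mul0l t : tensk_mul 0 t = 0.
Proof. by apply: (addrI (tensk_mul 0 t)); rewrite -tensk_mulDl !addr0. Qed.
Fact tensk_mul0r t : tensk_mul t 0 = 0.
Proof. by apply: (addrI (tensk_mul t 0)); rewrite -tensk_mulDr !addr0. Qed.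

Fact tensk_mulA : associative tensk_mul.
Proof.
move=> s t u; elim/tens_ind: s => [|a a'|s s' IH IH']; first by rewrite !tensk_mul0l.
  elim/tens_ind: t => [|b b'|t t' IH IH'].
  - by rewrite tensk_mul0l tensk_mul0r tensk_mul0l.
  - elim/tens_ind: u => [|c c'|u u' IH IH']; first by rewrite !tensk_mul0r.
    + by rewrite !tensk_mul_pure !mulrA.
    + by rewrite !tensk_mulDr IH IH'.
  - by rewrite tensk_mulDl !tensk_mulDr tensk_mulDl IH IH'.
by rewrite !tensk_mulDl IH IH'.
Qed.
Fact tensk_mul1l : left_id (1 \ox 1) tensk_mul.
Proof.
move=> s; elim/tens_ind: s => [|a a'|s s' IH IH']; first exact: tensk_mul0r.
- by rewrite tensk_mul_pure !mul1r.
- by rewrite tensk_mulDr IH IH'.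
Qed.
Fact tensk_mul1r : right_id (1 \ox 1) tensk_mul.
Proof.
move=> s; elim/tens_ind: s => [|a a'|s s' IH IH']; first exact: tensk_mul0l.
- by rewrite tensk_mul_pure !mulr1.
- by rewrite tensk_mulDl IH IH'.
Qed.

HB.instance Definition _ := GRing.Zmodule_isPzRing.Build (tensk A C)
  tensk_mulA tensk_mul1l tensk_mul1r tensk_mulDl tensk_mulDr.

Lemma tenskM a c b d :
  (a \ox c) * (b \ox d) = (a * b) \ox (c * d) :> tensk A C.
Proof. exact: tensk_mul_pure. Qed.
End TensAlgebra.

Lemma tliftM (k : fieldType) (A C : algType k) (P : lmodType k)
    (f : A -> C -> P) (s t : tensk A C) : bilin f ->
  \tens_(x, y <- s * t) f x y =
  \tens_(a, c <- s) \tens_(b, d <- t) f (a * b) (c * d).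
Proof.
move=> bf; rewrite [s * t]/(tensk_mul s t) /tensk_mul.
rewrite (tlift_comp _ _ (tliftk_linear bf)); apply: tlift_ext => a c.
rewrite (tlift_comp _ _ (tliftk_linear bf)); apply: tlift_ext => b d.
exact: tliftk_pure.
Qed.

Lemma tliftMl (k : fieldType) (A C : algType k) (P : lmodType k)
    (f : A -> C -> P) (a : A) (t : tensk A C) : bilin f ->
  \tens_(x, y <- (a \ox 1) * t) f x y = \tens_(x, y <- t) f (a * x) y.
Proof.
move=> bf; rewrite tliftM // tliftk_pure.
  by apply: tlift_ext => x y; rewrite mul1r.
by case: bf => fl fr; split=> [z e b b'|b e z z'];
  rewrite -tlift_lin; apply: tlift_ext => x y; rewrite mulPl; [exact: fl|exact: fr].
Qed.

Lemma tliftMr (k : fieldType) (A C : algType k) (P : lmodType k)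
    (f : A -> C -> P) (a : A) (t : tensk A C) : bilin f ->
  \tens_(x, y <- t * (a \ox 1)) f x y = \tens_(x, y <- t) f (x * a) y.
Proof.
move=> bf; rewrite tliftM //; apply: tlift_ext => x y.
rewrite tliftk_pure ?mulr1 //.
by case: bf => fl fr; split=> [z e b b'|b e z z']; rewrite mulPr; [exact: fl|exact: fr].
Qed.

Section Trilinear.
Variables (k : fieldType) (M N Q P : lmodType k).

Definition trilin (F : M -> N -> Q -> P) : Prop :=
  [/\ forall y z, linear (fun x => F x y z),
      forall x z, linear (fun y => F x y z) & forall x y, linear (F x y)].

Definition tlift3 (F : M -> N -> Q -> P) (t : tensk (tensk M N) Q) : P :=
  \tens_(u, z <- t) \tens_(x, y <- u) F x y z.

Lemma tlift3_bilin F : trilin F -> bilin (fun (u : tensk M N) z => \tens_(x, y <- u) F x y z).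
Proof.
case=> F1 F2 F3; split=> [z|u c z z'].
  by apply: tliftk_linear; split=> ? ? ? ?; [exact: F1|exact: F2].
by rewrite -tlift_lin; apply: tlift_ext => x y; exact: F3.
Qed.

Lemma tlift3_linear F : trilin F -> linear (tlift3 F).
Proof. by move=> /tlift3_bilin; exact: tliftk_linear. Qed.

Lemma tlift3_ox F u z : trilin F ->
  tlift3 F (u \ox z) = \tens_(x, y <- u) F x y z.
Proof. by move=> /tlift3_bilin; exact: tliftk_pure. Qed.

Lemma tlift3_pure F x y z : trilin F -> tlift3 F (x \ox y \ox z) = F x y z.
Proof.
by move=> tF; rewrite tlift3_ox // tliftk_pure //; case: tF => F1 F2 F3; split.
Qed.
End Trilinear.

(* The triple products are written out in Sweedler notation: with
   cop 1 = 1_1 (x) 1_2 = 1'_1 (x) 1'_2, the products (cop 1 (x) 1)(1 (x) cop 1)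
   and (1 (x) cop 1)(cop 1 (x) 1) are 1_1 (x) 1_2 1'_1 (x) 1'_2 and
   1_1 (x) 1'_1 1_2 (x) 1'_2. *)
HB.mixin Record isWeakBialgebra (k : fieldType) W of Falgebra k W := {
  cop : {linear W -> tensk W W};
  counit : {scalar W};
  copA : forall w,
    \tens_(x, y <- cop w) (cop x \ox y) =
    \tens_(x, y <- cop w) \tens_(y1, y2 <- cop y) (x \ox y1 \ox y2)
    :> tensk (tensk W W) W;
  counitl : forall w, \tens_(x, y <- cop w) (counit x *: y) = w;
  counitr : forall w, \tens_(x, y <- cop w) (counit y *: x) = w;
  copM : forall w v, cop (w * v) = cop w * cop v;
  cop1l :
    \tens_(x, y <- cop 1) (cop x \ox y) =
    \tens_(x, y <- cop 1) \tens_(x', y' <- cop 1) (x \ox (y * x') \ox y')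
    :> tensk (tensk W W) W;
  cop1r :
    \tens_(x, y <- cop 1) (cop x \ox y) =
    \tens_(x, y <- cop 1) \tens_(x', y' <- cop 1) (x \ox (x' * y) \ox y')
    :> tensk (tensk W W) W;
  counitMl : forall a b c,
    counit (a * b * c) = \tens_(x, y <- cop b) (counit (a * x) * counit (y * c));
  counitMr : forall a b c,
    counit (a * b * c) = \tens_(x, y <- cop b) (counit (a * y) * counit (x * c))
}.

#[short(type="weakBialgType")]
HB.structure Definition WeakBialgebra (k : fieldType) :=
  { W of isWeakBialgebra k W & Falgebra k W }.

Section Projections.
Variables (k : fieldType) (W : weakBialgType k).

Definition piL (w : W) : W := \tens_(x, y <- cop 1) (counit (x * w) *: y).
Definition piR (w : W) : W := \tens_(x, y <- cop 1) (counit (w * y) *: x).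

Fact piL_is_linear : linear piL.
Proof.
move=> c w v; rewrite -tlift_lin; apply: tlift_ext => x y.
by rewrite mulrDr -scalerAr linearP scalerDl scalerA.
Qed.
HB.instance Definition _ := GRing.isLinear.Build k W W _ piL piL_is_linear.

Definition WL : {vspace W} := limg (linfun piL).
End Projections.

HB.mixin Record hasAntipode (k : fieldType) W of WeakBialgebra k W := {
  antipode : {linear W -> W};
  antipodel : forall w : W, \tens_(x, y <- cop w) (antipode x * y) = piR w;
  antipoder : forall w : W, \tens_(x, y <- cop w) (x * antipode y) = piL w;
  antipodeE : forall w : W,
    \tens_(x, y <- cop w) \tens_(x1, x2 <- cop x)
      (antipode x1 * x2 * antipode y) = antipode w
}.

#[short(type="weakHopfType")]
HB.structure Definition WeakHopf (k : fieldType) :=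
  { W of hasAntipode k W & WeakBialgebra k W }.

Definition haar_integral (k : fieldType) (W : weakBialgType k) (h : W) : Prop :=
  [/\ forall w, w * h = piL w * h, forall w, h * w = h * piR w,
      piL h = 1 & piR h = 1].

Section Semisimple.
Variables (k : fieldType) (W : falgType k).

Definition left_ideal (U : {vspace W}) : bool := ({:W} * U <= U)%VS.

Definition minimal_left_ideal (U : {vspace W}) : Prop :=
  [/\ left_ideal U, U != 0%VS &
      forall V : {vspace W}, left_ideal V -> (V <= U)%VS -> V = 0%VS \/ V = U].

(* The left regular module is a finite direct sum of simple modules. *)
Definition semisimple_alg : Prop :=
  exists (n : nat) (U : 'I_n -> {vspace W}),
    [/\ forall i, minimal_left_ideal (U i),
        directv (\sum_(i < n) U i) & (\sum_(i < n) U i)%VS = fullv].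
End Semisimple.

Section WeakBialgebraTheory.
Variables (k : fieldType) (W : weakBialgType k) (P : lmodType k).
Variable F : W -> W -> W -> P.
Hypothesis trF : trilin F.

Let tlift3_copl (t : tensk W W) :
  tlift3 F (\tens_(x, y <- t) (cop x \ox y)) =
  \tens_(x, y <- t) \tens_(x1, x2 <- cop x) F x1 x2 y.
Proof.
rewrite (tlift_comp _ _ (tlift3_linear trF)); apply: tlift_ext => x y.
exact: tlift3_ox.
Qed.

Let tlift3_pures (T : W -> W -> tensk W W) (f g h : W -> W -> W -> W -> W) (t : tensk W W) :
  tlift3 F (\tens_(x, y <- t) \tens_(x', y' <- T x y)
    (f x y x' y' \ox g x y x' y' \ox h x y x' y')) =
  \tens_(x, y <- t) \tens_(x', y' <- T x y)
    F (f x y x' y') (g x y x' y') (h x y x' y').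
Proof.
rewrite (tlift_comp _ _ (tlift3_linear trF)); apply: tlift_ext => x y.
rewrite (tlift_comp _ _ (tlift3_linear trF)); apply: tlift_ext => x' y'.
exact: tlift3_pure.
Qed.

Lemma copA3 w :
  \tens_(x, y <- cop w) \tens_(x1, x2 <- cop x) F x1 x2 y =
  \tens_(x, y <- cop w) \tens_(y1, y2 <- cop y) F x y1 y2.
Proof. by rewrite -tlift3_copl copA tlift3_pures. Qed.

Lemma cop1l3 :
  \tens_(x, y <- cop (1 : W)) \tens_(x1, x2 <- cop x) F x1 x2 y =
  \tens_(x, y <- cop (1 : W)) \tens_(x', y' <- cop (1 : W)) F x (y * x') y'.
Proof. by rewrite -tlift3_copl cop1l tlift3_pures. Qed.

Lemma cop1r3 :
  \tens_(x, y <- cop (1 : W)) \tens_(x1, x2 <- cop x) F x1 x2 y =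
  \tens_(x, y <- cop (1 : W)) \tens_(x', y' <- cop (1 : W)) F x (x' * y) y'.
Proof. by rewrite -tlift3_copl cop1r tlift3_pures. Qed.
End WeakBialgebraTheory.

Section WeakBialgebraTheory2.
Variables (k : fieldType) (W : weakBialgType k).
Implicit Types w v z : W.

Lemma cop1M w : cop 1 * cop w = cop w.
Proof. by rewrite -copM mul1r. Qed.

Lemma cop_piLl w : cop (piL w) = (piL w \ox 1) * cop 1.
Proof.
pose F x y z : tensk W W := counit (x * w) *: (y \ox z).
have tF : trilin F by split=> ? ? ? ? ?; rewrite /F ?linE ?linearP /= ?linE.
have -> : (piL w \ox 1) * cop 1 = \tens_(x, y <- cop 1) ((piL w * x) \ox y).
  by rewrite -[LHS]tlift_tpure tliftMl //; exact: bilin_pure.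
rewrite [LHS](tlift_comp _ _ (linearP cop)).
transitivity (\tens_(x, y <- cop (1 : W)) \tens_(y1, y2 <- cop y) F x y1 y2).
  apply: tlift_ext => x y; rewrite linearZ /= -[X in _ *: X]tlift_tpure.
  exact: raddf_sum.
rewrite -copA3 // cop1l3 // tlift_exchange; apply: tlift_ext => x' y'.
have lin_x' : linear (fun v => (v * x') \ox y' : tensk W W).
  by move=> ? ? ?; rewrite !linE.
apply/esym; apply: etrans (tlift_comp _ _ lin_x') _.
by apply: tlift_ext => x y; rewrite (scalable_linear lin_x').
Qed.

Lemma cop_piLr w : cop (piL w) = cop 1 * (piL w \ox 1).
Proof.
pose F x y z : tensk W W := counit (x * w) *: (y \ox z).
have tF : trilin F by split=> ? ? ? ? ?; rewrite /F ?linE ?linearP /= ?linE.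
have -> : cop 1 * (piL w \ox 1) = \tens_(x, y <- cop 1) ((x * piL w) \ox y).
  by rewrite -[LHS]tlift_tpure tliftMr //; exact: bilin_pure.
rewrite [LHS](tlift_comp _ _ (linearP cop)).
transitivity (\tens_(x, y <- cop (1 : W)) \tens_(y1, y2 <- cop y) F x y1 y2).
  apply: tlift_ext => x y; rewrite linearZ /= -[X in _ *: X]tlift_tpure.
  exact: raddf_sum.
rewrite -copA3 // cop1r3 // tlift_exchange; apply: tlift_ext => x' y'.
have lin_x' : linear (fun v => (x' * v) \ox y' : tensk W W).
  by move=> ? ? ?; rewrite !linE.
apply/esym; apply: etrans (tlift_comp _ _ lin_x') _.
by apply: tlift_ext => x y; rewrite (scalable_linear lin_x').
Qed.

Lemma cop_piLM w v : cop (piL w * v) = (piL w \ox 1) * cop v.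
Proof. by rewrite copM cop_piLl -mulrA cop1M. Qed.

Lemma cop_MpiL w v : cop (v * piL w) = cop v * (piL w \ox 1).
Proof. by rewrite copM cop_piLr mulrA -copM mulr1. Qed.

Lemma counit_bilin : bilin (fun x y : W => counit x *: y).
Proof. by split=> ? ? ? ?; rewrite ?linE // ?linearP /= ?linE. Qed.

Lemma piL_cop w : \tens_(x, y <- cop w) (piL x * y) = w.
Proof.
rewrite -[RHS]counitl -[in RHS]cop1M [RHS]tliftM; last exact: counit_bilin.
rewrite [RHS]tlift_exchange; apply: tlift_ext => x y.
rewrite /piL (tlift_comp _ _ (fun c u v => mulPl c u v y)).
by apply: tlift_ext => x' y'; rewrite -scalerAl.
Qed.

Lemma piL_cop_piL w z : \tens_(x, y <- cop w) (piL (x * piL z) * y) = w * piL z.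
Proof.
rewrite -[RHS]piL_cop cop_MpiL tliftMr //.
by split=> ? ? ? ?; rewrite ?linE // ?linearP /= ?linE.
Qed.

Lemma cop1_piL : \tens_(x, y <- cop 1) (x \ox piL y) = cop 1 :> tensk W W.
Proof.
pose F (x y z : W) : tensk W W := counit y *: (x \ox z).
have tF : trilin F by split=> ? ? ? ? ?; rewrite /F ?linE ?linearP /= ?linE.
transitivity (\tens_(x, y <- cop (1 : W)) \tens_(x', y' <- cop (1 : W)) F x (x' * y) y').
  apply: tlift_ext => x y; rewrite (tlift_comp _ _ (fun c u v => oxPr c x u v)).
  by apply: tlift_ext => x' y'; rewrite oxZr.
rewrite -cop1r3 // -[RHS]tlift_tpure; apply: tlift_ext => x y.
rewrite -[x in RHS]counitr.
rewrite [RHS](tlift_comp _ _ (fun c u v => oxPl c u v y)).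
by apply: tlift_ext => x1 x2; rewrite oxZl.
Qed.

Definition piLb w : W := \tens_(x, y <- cop 1) (counit (y * w) *: x).

Lemma piL_piLb w : piL (piLb w) = piL w.
Proof.
apply: tlift_ext => x y; congr (_ *: _).
have lin_x : linear (fun v => counit (x * v) : k^o).
  by move=> ? ? ?; rewrite linE linearP.
rewrite [LHS](tlift_comp _ _ lin_x) -[x in RHS]mulr1 counitMl.
apply: tlift_ext => x' y'; rewrite (scalable_linear lin_x).
by rewrite mulrC.
Qed.

Lemma piLb_cop w :
  \tens_(x, y <- cop w) (piLb x \ox y) = \tens_(x, y <- cop 1) (x \ox (y * w)).
Proof.
pose F p q r : tensk W W :=
  \tens_(x, y <- cop w) (counit (q * x) *: (p \ox (r * y))).
have tF : trilin F.
  by split=> ? ? ? ? ?; rewrite /F -tlift_lin; apply: tlift_ext => *;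
    rewrite ?linE ?linearP /= ?linE.
have bG : bilin (fun x y : W => piLb x \ox y).
  split=> ? ? ? ?; last by rewrite !linE.
  rewrite -oxPl; congr (_ \ox _); rewrite -tlift_lin; apply: tlift_ext => *.
  by rewrite !linE linearP /= !linE.
rewrite -cop1M tliftM //.
transitivity (\tens_(x, y <- cop (1 : W)) \tens_(x', y' <- cop (1 : W)) F x (y * x') y').
  rewrite [RHS]tlift_exchange; apply: tlift_ext => x' y'.
  rewrite [RHS]tlift_exchange; apply: tlift_ext => x y.
  rewrite [LHS](tlift_comp _ _ (fun c u v => oxPl c u v (y' * y))).
  by apply: tlift_ext => p q; rewrite mulrA oxZl.
rewrite -cop1l3 // copA3 //; apply: tlift_ext => p q.
rewrite -[q * w]counitl copM tliftM; last exact: counit_bilin.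
rewrite (tlift_comp _ _ (fun c u v => oxPr c p u v)); apply: tlift_ext => q1 q2.
rewrite (tlift_comp _ _ (fun c u v => oxPr c p u v)); apply: tlift_ext => x y.
by rewrite oxZr.
Qed.

Lemma piL_copE w :
  \tens_(x, y <- cop w) (piL x \ox y) =
  \tens_(x, y <- cop 1) (piL x \ox (y * w)).
Proof.
pose G (t : tensk W W) : tensk W W := \tens_(x, y <- t) (piL x \ox y).
have lG : linear G by apply: tliftk_linear; split=> ? ? ? ?; rewrite ?linE // ?linearP /= ?linE.
have Gp x y : G (x \ox y) = piL x \ox y.
  by apply: tliftk_pure; split=> ? ? ? ?; rewrite ?linE // ?linearP /= ?linE.
transitivity (G (\tens_(x, y <- cop w) (piLb x \ox y))).
  rewrite (tlift_comp _ _ lG); apply: tlift_ext => x y.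
  by rewrite Gp piL_piLb.
by rewrite piLb_cop (tlift_comp _ _ lG); apply: tlift_ext.
Qed.
End WeakBialgebraTheory2.

Definition wdual (k : fieldType) (W : weakBialgType k) : Type := 'Hom(W, k^o).
HB.instance Definition _ (k : fieldType) (W : weakBialgType k) :=
  Vector.on (wdual W).

Section Dual.
Variables (k : fieldType) (W : weakBialgType k).
Implicit Types f g : wdual W.

Definition conv_fun f g (w : W) : k^o := \tens_(x, y <- cop w) (f x * g y : k^o).

Fact conv_bilin f g : bilin (fun x y : W => f x * g y : k^o).
Proof. by split=> ? ? ? ?; rewrite linearP ?mulPl ?mulPr. Qed.

Fact conv_fun_linear f g : linear (conv_fun f g).
Proof.
move=> c w v; rewrite /conv_fun linearP; exact: (tliftk_linear (conv_bilin f g)).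
Qed.
HB.instance Definition _ f g :=
  GRing.isLinear.Build k W k^o _ (conv_fun f g) (conv_fun_linear f g).

Definition conv f g : wdual W := linfun (conv_fun f g).
Definition conv1 : wdual W := linfun (counit : W -> k^o).

Fact convE f g w : conv f g w = \tens_(x, y <- cop w) (f x * g y : k^o).
Proof. exact: lfunE. Qed.
Fact conv1E w : conv1 w = counit w.
Proof. exact: lfunE. Qed.

Fact convA : associative conv.
Proof.
move=> f g h; apply/lfunP => w; rewrite !convE.
have trF : trilin (fun x y z : W => f x * (g y * h z) : k^o).
  by split=> ? ? ? ? ?; rewrite linearP ?(mulPl, mulPr).
transitivity (\tens_(x, y <- cop w) \tens_(y1, y2 <- cop y) (f x * (g y1 * h y2) : k^o)).
  by apply: tlift_ext => x y; rewrite convE /tlift mulr_sumr.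
rewrite -(copA3 trF); apply: tlift_ext => x y; rewrite convE /tlift mulr_suml.
by apply: eq_bigr => p _; rewrite mulrA.
Qed.
Fact conv1l : left_id conv1 conv.
Proof.
move=> f; apply/lfunP => w; rewrite convE -[w in RHS]counitl [RHS]raddf_sum.
by apply: eq_bigr => p _; rewrite /= linearZ conv1E.
Qed.
Fact conv1r : right_id conv1 conv.
Proof.
move=> f; apply/lfunP => w; rewrite convE -[w in RHS]counitr [RHS]raddf_sum.
by apply: eq_bigr => p _; rewrite /= linearZ conv1E mulrC.
Qed.
Fact convDl : left_distributive conv +%R.
Proof.
move=> f g h; apply/lfunP => w; rewrite add_lfunE !convE /tlift -big_split.
by apply: eq_bigr => p _; rewrite add_lfunE mulrDl.
Qed.
Fact convDr : right_distributive conv +%R.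
Proof.
move=> f g h; apply/lfunP => w; rewrite add_lfunE !convE /tlift -big_split.
by apply: eq_bigr => p _; rewrite add_lfunE mulrDr.
Qed.
Fact conv1_neq0 : conv1 != 0.
Proof.
apply/eqP => c0; have /eqP[] := oner_neq0 W.
rewrite -[LHS]counitl; apply: big1 => p _.
by rewrite -conv1E c0 zero_lfunE scale0r.
Qed.
HB.instance Definition _ := GRing.Zmodule_isNzRing.Build (wdual W)
  convA conv1l conv1r convDl convDr conv1_neq0.

Fact conv_scaleAl (c : k) f g : c *: (f * g) = (c *: f) * g.
Proof.
apply/lfunP => w; rewrite scale_lfunE !convE /tlift scaler_sumr.
by apply: eq_bigr => p _; rewrite scale_lfunE scalerAl.
Qed.
HB.instance Definition _ := GRing.Lmodule_isLalgebra.Build k (wdual W) conv_scaleAl.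

Fact conv_scaleAr (c : k) f g : c *: (f * g) = f * (c *: g).
Proof.
apply/lfunP => w; rewrite scale_lfunE !convE /tlift scaler_sumr.
by apply: eq_bigr => p _; rewrite scale_lfunE scalerAr.
Qed.
HB.instance Definition _ := GRing.Lalgebra_isAlgebra.Build k (wdual W) conv_scaleAr.
End Dual.

HB.mixin Record isModuleAlgebra (k : fieldType) (W : weakBialgType k) A
    of GRing.Algebra k A := {
  act : W -> A -> A;
  act_linearl : forall a, linear (act^~ a);
  act_linearr : forall w, linear (act w);
  act1 : forall a, act 1 a = a;
  actM : forall w v a, act (w * v) a = act w (act v a);
  act_mul : forall w a b,
    act w (a * b) = \tens_(x, y <- cop w) (act x a * act y b);
  act_one : forall w, act w 1 = act (piL w) 1
}.

#[short(type="moduleAlgType")]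
HB.structure Definition ModuleAlgebra (k : fieldType) (W : weakBialgType k) :=
  { A of isModuleAlgebra k W A & GRing.Algebra k A }.

Section Invariants.
Variables (k : fieldType) (W : weakBialgType k) (A : moduleAlgType W).
Implicit Types (w v : W) (a b : A).

Lemma actPl a c w v : act (c *: w + v) a = c *: act w a + act v a.
Proof. exact: act_linearl. Qed.
Lemma actPr w c a b : act w (c *: a + b) = c *: act w a + act w b.
Proof. exact: act_linearr. Qed.

Fact act2_bilin a b : bilin (fun x y : W => act x a * act y b).
Proof. by split=> ? ? ? ?; rewrite actPl linE. Qed.

Lemma act_piL w a : act (piL w) a = act (piL w) 1 * a.
Proof.
rewrite -[a in LHS]mul1r act_mul cop_piLr tliftMr; last exact: act2_bilin.
rewrite -[RHS]act1 act_mul; apply: tlift_ext => x y.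
by rewrite actM.
Qed.

Definition invariant b : Prop := forall w, act w b = act (piL w) b.

Lemma act_mul_inv w a b : invariant b -> act w (a * b) = act w a * b.
Proof.
move=> bI; rewrite -[a in RHS]mulr1 !act_mul /tlift mulr_suml.
by apply: eq_bigr => p _; rewrite bI act_piL -act_one mulrA.
Qed.

Lemma act_inv_mul w a b : invariant b -> act w (b * a) = b * act w a.
Proof.
move=> bI; have bG v : bilin (fun x y : W => act x b * act (y * v) a).
  by split=> ? ? ? ?; rewrite ?linE actPl linE.
pose G (t : tensk W W) : A := \tens_(x, y <- t) (act x b * act y a).
have lG : linear G by exact/tliftk_linear/act2_bilin.
have Gp x y : G (x \ox y) = act x b * act y a by exact/tliftk_pure/act2_bilin.
transitivity (G (\tens_(x, y <- cop w) (piL x \ox y))).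
  rewrite act_mul (tlift_comp _ _ lG); apply: tlift_ext => x y.
  by rewrite Gp -bI.
rewrite piL_copE (tlift_comp _ _ lG) -[RHS]act1 act_mul; apply: tlift_ext => x y.
by rewrite Gp -bI actM.
Qed.

Definition inv_pred : {pred A} := fun b => `[< invariant b >].

Lemma inv_predP b : reflect (invariant b) (b \in inv_pred).
Proof. exact: asboolP. Qed.

Fact inv_subalg_closed : subalg_closed inv_pred.
Proof.
split=> [|c a b /inv_predP aI /inv_predP bI|a b /inv_predP aI /inv_predP bI];
  apply/inv_predP => w.
- exact: act_one.
- by rewrite !actPr aI bI.
- by rewrite !act_mul_inv // aI.
Qed.
HB.instance Definition _ :=
  GRing.isSubalgClosed.Build k A inv_pred
    (GRing.subalg_closed_semi inv_subalg_closed).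

Record invariants : Type := Invariants {
  inv_val :> A;
  inv_valP : inv_val \in inv_pred }.
HB.instance Definition _ := [isSub for inv_val].
HB.instance Definition _ := [Choice of invariants by <:].
HB.instance Definition _ := [SubChoice_isSubAlgebra of invariants by <:].

(* A as a right module over B = A^W, i.e. a left module over B^c. *)
Definition rightB : Type := A.
HB.instance Definition _ := GRing.Zmodule.on rightB.
Definition rightB_scale (b : invariants^c) (x : rightB) : rightB :=
  (x : A) * inv_val b.

Fact rightB_scaleA (b c : invariants^c) x :
  rightB_scale b (rightB_scale c x) = rightB_scale (b * c) x.
Proof. by rewrite /rightB_scale -mulrA. Qed.
Fact rightB_scale1 : left_id 1 rightB_scale.
Proof. by move=> x; exact: mulr1. Qed.
Fact rightB_scaleDr : right_distributive rightB_scale +%R.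
Proof. by move=> b x y; exact: mulrDl. Qed.
Fact rightB_scaleDl x : {morph rightB_scale^~ x : b c / b + c}.
Proof. by move=> b c; exact: mulrDr. Qed.
HB.instance Definition _ := GRing.Zmodule_isLmodule.Build invariants^c rightB
  rightB_scaleA rightB_scale1 rightB_scaleDr rightB_scaleDl.
End Invariants.

Section Smash.
Variables (k : fieldType) (W : weakBialgType k) (A : moduleAlgType W).
Implicit Types (w v u : W) (a b c : A).

(* W^L acts on A from the right by a.z = a (z.1), which equals S^-1(z).a. *)
Definition smash : Type :=
  @tensor k A W (subvs_of (WL W))
    (fun z a => a * act (vsval z) 1) (fun z w => vsval z * w).
HB.instance Definition _ := GRing.Lmodule.on smash.

Definition spure a w : smash := tpure _ _ a w.

Lemma spurePl e a b w : spure (e *: a + b) w = e *: spure a w + spure b w.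
Proof. by case: (balanced_pure (k := k) (M := A) (N := W) (fun (z : subvs_of (WL W)) a => a * act (vsval z) 1) (fun z w => vsval z * w)) => + _ _; apply. Qed.
Lemma spurePr e a w v : spure a (e *: w + v) = e *: spure a w + spure a v.
Proof. by case: (balanced_pure (k := k) (M := A) (N := W) (fun (z : subvs_of (WL W)) a => a * act (vsval z) 1) (fun z w => vsval z * w)) => _ + _; apply. Qed.

Lemma WL_P (z : subvs_of (WL W)) : exists w, vsval z = piL w.
Proof.
by have /memv_imgP[w _ ->] := subvsP z; exists w; rewrite lfunE.
Qed.

Lemma spure_piL a u w : spure (a * act (piL u) 1) w = spure a (piL u * w).
Proof.
have zP : piL u \in WL W by rewrite -[piL u]lfunE memv_img ?memvf.
exact: (tpure_bal _ _ (Subvs zP)).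
Qed.

Definition smash_mul (s t : smash) : smash :=
  \tens_(a, w <- s) \tens_(b, v <- t)
    \tens_(x, y <- cop w) spure (a * act x b) (y * v).

Definition slinE := (linE, (@actPl k W A, @actPr k W A), (spurePl, spurePr)).

Fact smash_mul_bilin a b v : bilin (fun x y : W => spure (a * act x b) (y * v)).
Proof. by split=> ? ? ? ?; rewrite ?slinE. Qed.

Fact smash_mul_balr a w :
  balanced (fun (z : subvs_of (WL W)) a => a * act (vsval z) 1)
    (fun z w => vsval z * w)
    (fun b v => \tens_(x, y <- cop w) spure (a * act x b) (y * v)).
Proof.
split=> [v e b b'|b e v v'|z b v].
- by rewrite -tlift_lin; apply: tlift_ext => x y; rewrite ?slinE.
- by rewrite -tlift_lin; apply: tlift_ext => x y; rewrite ?slinE.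
have [u ->] := WL_P z.
pose F (x1 x2 y : W) := spure (a * (act x1 b * act (x2 * piL u) 1)) (y * v).
have trF : trilin F by split=> ? ? ? ? ?; rewrite /F ?slinE.
transitivity (\tens_(x, y <- cop w) \tens_(x1, x2 <- cop x) F x1 x2 y).
  apply: tlift_ext => x y; rewrite act_mul.
  have lin_y : linear (fun d => spure (a * d) (y * v)) by move=> ? ? ?; rewrite ?slinE.
  rewrite (tlift_comp _ _ lin_y); apply: tlift_ext => x1 x2.
  by rewrite -actM.
rewrite copA3 //; apply: tlift_ext => x y.
have lin_x : linear (fun r => spure (a * act x b) (r * v)).
  by move=> ? ? ?; rewrite ?slinE.
rewrite mulrA -(piL_cop_piL y u) (tlift_comp _ _ lin_x); apply: tlift_ext => y1 y2.
by rewrite /F act_one mulrA spure_piL mulrA.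
Qed.

Fact smash_mul_ball (t : smash) :
  balanced (fun (z : subvs_of (WL W)) a => a * act (vsval z) 1)
    (fun z w => vsval z * w)
    (fun a w => \tens_(b, v <- t) \tens_(x, y <- cop w) spure (a * act x b) (y * v)).
Proof.
split=> [w e a a'|a e w w'|z a w].
- rewrite -tlift_lin; apply: tlift_ext => b v; rewrite -tlift_lin.
  by apply: tlift_ext => x y; rewrite ?slinE.
- rewrite -tlift_lin; apply: tlift_ext => b v; rewrite linearP.
  exact/tliftk_linear/smash_mul_bilin.
have [u ->] := WL_P z; apply: tlift_ext => b v.
rewrite cop_piLM tliftMl; last exact: smash_mul_bilin.
by apply: tlift_ext => x y; rewrite actM [in RHS]act_piL mulrA.
Qed.

Fact smash_mul_linearl t : linear (smash_mul^~ t).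
Proof. exact/tlift_linear/smash_mul_ball. Qed.
Fact smash_mul_linearr s : linear (smash_mul s).
Proof.
move=> e t u; rewrite /smash_mul -tlift_lin; apply: tlift_ext => a w.
exact/tlift_linear/smash_mul_balr.
Qed.

Lemma smash_mul_pure a w b v :
  smash_mul (spure a w) (spure b v) =
  \tens_(x, y <- cop w) spure (a * act x b) (y * v).
Proof.
rewrite /smash_mul tlift_pure; last exact: smash_mul_ball.
by rewrite tlift_pure //; exact: smash_mul_balr.
Qed.

Fact smash_mulDl : left_distributive smash_mul +%R.
Proof. by move=> s t u; have := smash_mul_linearl u 1 s t; rewrite !scale1r. Qed.
Fact smash_mulDr : right_distributive smash_mul +%R.
Proof. by move=> s t u; have := smash_mul_linearr s 1 t u; rewrite !scale1r. Qed.
Fact smash_mul0l t : smash_mul 0 t = 0.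
Proof. by apply: (addrI (smash_mul 0 t)); rewrite -smash_mulDl !addr0. Qed.
Fact smash_mul0r t : smash_mul t 0 = 0.
Proof. by apply: (addrI (smash_mul t 0)); rewrite -smash_mulDr !addr0. Qed.

Fact smash_mulA_pure a w b v c u :
  smash_mul (spure a w) (smash_mul (spure b v) (spure c u)) =
  smash_mul (smash_mul (spure a w) (spure b v)) (spure c u).
Proof.
rewrite !smash_mul_pure (tlift_comp _ _ (smash_mul_linearr (spure a w))).
rewrite (tlift_comp _ _ (smash_mul_linearl (spure c u))).
transitivity (\tens_(x, y <- cop w) \tens_(v1, v2 <- cop v)
    spure (a * act x (b * act v1 c)) (y * (v2 * u))).
  by rewrite [RHS]tlift_exchange; apply: tlift_ext => v1 v2; rewrite smash_mul_pure.
pose F (x1 x2 y : W) := \tens_(v1, v2 <- cop v)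
  spure (a * act x1 b * act (x2 * v1) c) (y * v2 * u).
have trF : trilin F.
  split=> ? ? ? ? ?; rewrite /F -tlift_lin; apply: tlift_ext => ? ?;
    by rewrite ?slinE.
transitivity (\tens_(x, y <- cop w) \tens_(x1, x2 <- cop x) F x1 x2 y).
  apply: tlift_ext => x y; rewrite [RHS]tlift_exchange.
  apply: tlift_ext => v1 v2; rewrite act_mul.
  have lin_y : linear (fun d => spure (a * d) (y * (v2 * u))).
    by move=> ? ? ?; rewrite ?slinE.
  rewrite (tlift_comp _ _ lin_y); apply: tlift_ext => x1 x2.
  by rewrite actM !mulrA.
rewrite copA3 //; apply: tlift_ext => x y; rewrite smash_mul_pure copM tliftM //.
exact: smash_mul_bilin.
Qed.

Fact smash_mulA : associative smash_mul.
Proof.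
move=> s t u; elim/tens_ind: s => [|a w|s s' IH IH']; first by rewrite !smash_mul0l.
  elim/tens_ind: t => [|b v|t t' IH IH'].
  - by rewrite smash_mul0l smash_mul0r smash_mul0l.
  - elim/tens_ind: u => [|c u|u u' IH IH']; first by rewrite !smash_mul0r.
    + exact: smash_mulA_pure.
    + by rewrite !smash_mulDr IH IH'.
  - by rewrite smash_mulDl !smash_mulDr smash_mulDl IH IH'.
by rewrite !smash_mulDl IH IH'.
Qed.

Fact smash_mul1l : left_id (spure 1 1) smash_mul.
Proof.
elim/tens_ind => [|b v|s s' IH IH']; first exact: smash_mul0r.
  rewrite smash_mul_pure.
  pose G (t : tensk W W) : smash := \tens_(x, y <- t) spure (1 * act x b) (y * v).
  have lG : linear G by exact/tliftk_linear/smash_mul_bilin.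
  have Gp x y : G (x \ox y) = spure (1 * act x b) (y * v).
    exact/tliftk_pure/smash_mul_bilin.
  rewrite -[LHS]/(G (cop 1)) -cop1_piL (tlift_comp _ _ lG).
  rewrite -[tpure _ _ _ _]/(spure b v) -[b in RHS]act1 -[b in RHS]mulr1 act_mul.
  rewrite (tlift_comp _ _ (fun r d e => spurePl r d e v)); apply: tlift_ext => x y.
  by rewrite Gp mul1r -spure_piL -act_one.
by rewrite smash_mulDr IH IH'.
Qed.

Fact smash_mul1r : right_id (spure 1 1) smash_mul.
Proof.
elim/tens_ind => [|b v|s s' IH IH']; first exact: smash_mul0l.
  rewrite smash_mul_pure -[tpure _ _ _ _]/(spure b v) -[v in RHS]piL_cop.
  rewrite (tlift_comp _ _ (fun r d e => spurePr r b d e)); apply: tlift_ext => x y.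
  by rewrite act_one spure_piL mulr1.
by rewrite smash_mulDl IH IH'.
Qed.

HB.instance Definition _ := GRing.Zmodule_isPzRing.Build smash
  smash_mulA smash_mul1l smash_mul1r smash_mulDl smash_mulDr.

Definition smash_act (s : smash) (x : A) : A := \tens_(a, w <- s) (a * act w x).

Fact smash_act_bal x :
  balanced (fun (z : subvs_of (WL W)) a => a * act (vsval z) 1)
    (fun z w => vsval z * w) (fun a w => a * act w x).
Proof.
split=> [w e a a'|a e w w'|z a w]; rewrite ?slinE //.
by have [u ->] := WL_P z; rewrite actM [act _ (act w x)]act_piL mulrA.
Qed.

Lemma smash_act_pure a w x : smash_act (spure a w) x = a * act w x.
Proof. exact/tlift_pure/smash_act_bal. Qed.

Lemma smash_act_linear x : linear (smash_act^~ x).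
Proof. exact/tlift_linear/smash_act_bal. Qed.
End Smash.

Section Galois.
Variables (k : fieldType) (W : weakBialgType k) (A : moduleAlgType W).
Implicit Types (w : W) (a x y : A).

Definition tensB : Type :=
  @tensor k A A (invariants A)
    (fun b x => x * inv_val b) (fun b y => inv_val b * y).
HB.instance Definition _ := GRing.Lmodule.on tensB.

Definition dpair (f : wdual W) (w : W) : k := f w.

(* This determines rho, as t |-> (w |-> t_1 <t_2, w>) is injective. *)
Definition is_coaction (rho : {linear A -> tensk A (wdual W)}) : Prop :=
  forall w a, act w a = \tens_(x, f <- rho a) (dpair f w *: x).

Definition galois_map (rho : A -> tensk A (wdual W)) (t : tensB) :
    tensk A (wdual W) :=
  \tens_(x, y <- t) \tens_(y0, y1 <- rho y) ((x * y0) \ox y1).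

Let pair w (t : tensk A (wdual W)) : A := \tens_(x, f <- t) (dpair f w *: x).

Let pair_bilin w : bilin (fun (x : A) (f : wdual W) => dpair f w *: x).
Proof.
split=> [f e x x'|x e f f']; first by rewrite linE.
by rewrite /dpair add_lfunE scale_lfunE scalePl.
Qed.

Let pair_inj s t : (forall w, pair w s = pair w t) -> s = t.
Proof.
pose e := vbasis {:W}.
have eW : basis_of {:W} e by exact: vbasisP.
pose d i : wdual W := linfun (coord e i : W -> k^o).
have tE (u : tensk A (wdual W)) : u = \sum_(i < \dim {:W}) (pair e`_i u) \ox d i.
  rewrite -[LHS]tlift_tpure.
  transitivity (\tens_(x, f <- u) \sum_(i < \dim {:W}) (dpair f e`_i *: x) \ox d i).
    apply: tlift_ext => x f.
    have fE : f = \sum_(i < \dim {:W}) (f e`_i) *: d i.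
      apply/lfunP => w; rewrite sum_lfunE [in LHS](coord_basis eW (memvf w)).
      rewrite linear_sum; apply: eq_bigr => i _.
      by rewrite linearZ scale_lfunE lfunE; exact: mulrC.
    rewrite -[tpure _ _ _ _]/(x \ox f) [in LHS]fE.
    have lx : linear (fun f : wdual W => x \ox f) by move=> ? ? ?; rewrite linE.
    pose G := GRing.isLinear.Build _ _ _ _ _ lx.
    pose g : {linear wdual W -> tensk A (wdual W)} := HB.pack (fun f : wdual W => x \ox f) G.
    rewrite -[LHS]/(g _) linear_sum; apply: eq_bigr => i _.
    by rewrite /= oxZl oxZr.
  rewrite /tlift exchange_big; apply: eq_bigr => i _ /=.
  have ld : linear (fun y : A => y \ox d i) by move=> ? ? ?; rewrite linE.
  by rewrite [RHS](tlift_comp _ _ ld).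
by move=> st; rewrite (tE s) (tE t); apply: eq_bigr => i _; rewrite st.
Qed.

Let rho_inv (rho : {linear A -> tensk A (wdual W)}) a (b : invariants A) :
  is_coaction rho -> rho (inv_val b * a) = (inv_val b \ox 1) * rho a.
Proof.
move=> rhoE; apply: pair_inj => w; rewrite -[LHS]rhoE /pair tliftMl //.
rewrite act_inv_mul; last exact/inv_predP/inv_valP.
by rewrite rhoE /tlift mulr_sumr; apply: eq_bigr => p _; rewrite scalerAr.
Qed.

Section GaloisMap.
Variable rho : {linear A -> tensk A (wdual W)}.
Hypothesis rhoE : is_coaction rho.

Let mul_bilin x : bilin (fun y0 (f : wdual W) => (x * y0) \ox f).
Proof. by split=> ? ? ? ?; rewrite !linE. Qed.

Fact galois_map_bal :
  balanced (fun (b : invariants A) x => x * inv_val b)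
    (fun b y => inv_val b * y)
    (fun x y => \tens_(y0, y1 <- rho y) ((x * y0) \ox y1 : tensk A (wdual W))).
Proof.
split=> [y e x x'|x e y y'|b x y].
- by rewrite -tlift_lin; apply: tlift_ext => y0 y1; rewrite !linE.
- by rewrite linearP; exact/tliftk_linear/mul_bilin.
rewrite rho_inv // tliftMl; last exact: mul_bilin.
by apply: tlift_ext => y0 y1; rewrite mulrA.
Qed.

Lemma galois_map_pure x y :
  galois_map rho (tpure _ _ x y) = \tens_(y0, y1 <- rho y) ((x * y0) \ox y1).
Proof. exact/tlift_pure/galois_map_bal. Qed.

Lemma galois_map_linear : linear (galois_map rho).
Proof. exact/tlift_linear/galois_map_bal. Qed.
End GaloisMap.
End Galois.

Definition linear_iso_onto (k : fieldType) (U V : lmodType k) (f : U -> V)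
    (P : V -> Prop) : Prop :=
  [/\ linear f, injective f & forall v, P v <-> exists u, f u = v].

Definition left_ideal_gen (T : pzRingType) (t v : T) : Prop :=
  exists s : T, v = s * t.

(* [smash_act] is an isomorphism of A # W onto the algebra End A_B of right
   B-linear endomorphisms of A, with composition as multiplication. *)
Definition smash_act_iso (k : fieldType) (W : weakBialgType k)
    (A : moduleAlgType W) : Prop :=
  [/\ forall x, linear (fun s : smash A => smash_act s x),
      smash_act (1 : smash A) = id,
      forall s t : smash A, smash_act (s * t) = smash_act s \o smash_act t,
      injective (@smash_act k W A) &
      forall f : A -> A,
        linear (f : rightB A -> rightB A) <-> exists s : smash A, smash_act s = f].

Definition finitely_generated (R : pzRingType) (M : lmodType R) : Prop :=
  exists (n : nat) (g : 'I_n -> M),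
    forall x, exists c : 'I_n -> R, x = \sum_(i < n) c i *: g i.

Definition projective (R : pzRingType) (M : lmodType R) : Prop :=
  forall (P Q : lmodType R) (p : {linear P -> Q}) (f : {linear M -> Q}),
    (forall q, exists x, p x = q) ->
    exists g : {linear M -> P}, forall x, p (g x) = f x.

Definition finite_projective (R : pzRingType) (M : lmodType R) : Prop :=
  finitely_generated M /\ projective M.

(* Main.v *)
Require Import Defs.
From HB Require Import structures.
From mathcomp Require Import all_boot all_order all_algebra all_field.
From mathcomp Require Import boolp.

Set Implicit Arguments.
Unset Strict Implicit.
Unset Printing Implicit Defensive.

Import GRing.Theory.
Local Open Scope ring_scope.

(** Call a finite family of pairs (x_i, y_i) in A full when

      sum_i (x_i # h)(y_i # 1) = 1   in A # W,

    that is, when it witnesses that the two-sided ideal of A # W generated by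
    the idempotent 1 # h is everything: the Morita context relating A # W and
    B = A^W is then strict on the side of A # W.  The proof shows that each of
    the two conditions of the theorem is equivalent to the existence of a full
    family ([haar_full]).

    An element t of A (x) W^* is handled as the linear map w |-> t_0 <t_1, w>
    from W to A ([teval]).  The product becomes convolution, rho a becomes
    w |-> w.a, beta (x (x) y) becomes w |-> x (w.y), and the left ideal
    generated by rho 1 becomes the set of g with g(w) = g(w_1)(w_2.1).

    What is needed of W is that h is nondegenerate.  It follows from the rules
    S(a)h_1 (x) h_2 = h_1 (x) a h_2 and h_1 a (x) h_2 = h_1 (x) h_2 S(a):
    by the first, the second legs of Delta(h) span a left ideal, and this ideal
    contains S(h_1) h_2 = Pi^R(h) = 1; by the second, the first legs span a
    right ideal, which contains h_1 S(h_2) = Pi^L(h) = 1.  So there is a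
    functional lambda with lambda(h_1) h_2 = 1 ([haar_dual_ex]), every w in W
    has the form h_1 f(h_2) ([haar_span]), and S is bijective
    ([antipode_surj]).

    - If beta is onto, a preimage sum_i x_i (x) y_i of
      w |-> lambda(w_1)(w_2.1) is a full family, because
      sum_i (x_i # h)(y_i # 1) = sum_i x_i (h_1.y_i) # h_2
      ([galois_surj_full]).
    - A full family gives a = sum_i x_i (h.(y_i a)) for all a, which is a dual
      basis of A over B.  It also gives the inverse
      f |-> sum_i (f(x_i) # h)(y_i # 1) of pi; injectivity of pi comes from
      s (x # h) = pi(s)(x) # h ([full_iso], [full_finite_projective]).
    - If pi is bijective and (x_i, f_i) is a dual basis of A over B, each f_i is
      some pi(s_i) with values in B, so f_i = h.f_i.  As S is onto, the rules for
      h turn h.(pi(s)(a)) into h.(y a) for some y that depends on s alone.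
      The resulting family (x_i, y_i) is full by injectivity of pi
      ([iso_full]).
    - Given a full family, beta is injective because A is projective over B and
      (h.x) b = h_1.(x (S(h_2).b)); it is onto because
      sum_i g(h_1) x_i (x) S^-1(h_2).y_i is a preimage of g
      ([full_galois_inj], [full_galois_surj]). *)

(** * Linear maps and sums over tensors *)

Lemma lin_sum (k : fieldType) (U V : lmodType k) (f : U -> V) : linear f ->
  forall (J : Type) (s : seq J) (F : J -> U),
  f (\sum_(j <- s) F j) = \sum_(j <- s) f (F j).
Proof.
move=> lf J s F; pose G := GRing.isLinear.Build _ _ _ _ f lf.
pose g : {linear U -> V} := HB.pack f G.
exact: (raddf_sum g).
Qed.

Lemma lin0 (k : fieldType) (U V : lmodType k) (f : U -> V) : linear f -> f 0 = 0.
Proof.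
move=> lf; have := lin_sum lf [::] (fun n : nat => 0).
by rewrite !big_nil.
Qed.

Lemma linD (k : fieldType) (U V : lmodType k) (f : U -> V) : linear f ->
  {morph f : x y / x + y}.
Proof. by move=> lf x y; have := lf 1 x y; rewrite !scale1r. Qed.

Lemma tlift_bind (k : fieldType) (M N M' N' P : lmodType k) I
    (r : I -> M -> M) (l : I -> N -> N) (t : tensor r l)
    (T : M -> N -> tensk M' N') (F : M' -> N' -> P) : bilin F ->
  \tens_(x, y <- \tens_(a, b <- t) T a b) F x y =
  \tens_(a, b <- t) \tens_(x, y <- T a b) F x y.
Proof. by move=> bF; apply: tlift_comp; apply: tliftk_linear. Qed.

Lemma tlift_ox (k : fieldType) (M N : lmodType k) (t : tensk M N) :
  \tens_(x, y <- t) (x \ox y) = t.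
Proof. exact: tlift_tpure. Qed.

(** * Sweedler calculus in a weak bialgebra *)

Section WeakBialgebra.
Variables (k : fieldType) (W : weakBialgType k) (P : lmodType k).
Implicit Types (u v w : W).

Lemma piR_linear : linear (@piR k W).
Proof.
move=> e u v; rewrite /piR -tlift_lin; apply: tlift_ext => x y.
by rewrite linE linearP /= linE.
Qed.

(** Apply epsilon(w -) to the last leg of
    (Delta (x) id) Delta(1) = 1_1 (x) 1_2 1'_1 (x) 1'_2. *)
Lemma cop_piR w : cop (piR w) = cop 1 * (1 \ox piR w).
Proof.
pose F x y z : tensk W W := counit (w * z) *: (x \ox y).
have tF : trilin F by split=> ? ? ? ? ?; rewrite /F ?linE ?linearP /= ?linE.
transitivity (\tens_(x, y <- cop (1 : W)) \tens_(x1, x2 <- cop x) F x1 x2 y).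
  rewrite [LHS](tlift_comp _ _ (linearP cop)); apply: tlift_ext => x y.
  by rewrite linearZ /= -[in LHS](tlift_ox (cop x)); exact: raddf_sum.
rewrite cop1l3 // -[RHS]tlift_ox tliftM; last exact: bilin_pure.
apply: tlift_ext => x y.
rewrite tliftk_pure; last by split=> ? ? ? ?; rewrite ?linE.
rewrite mulr1.
have lz : linear (fun z => x \ox (y * z)) by move=> ? ? ?; rewrite ?linE.
rewrite (tlift_comp _ _ lz); apply: tlift_ext => x' y'.
by rewrite /F (scalable_linear lz).
Qed.

Variable F : W -> W -> P.
Hypothesis bF : bilin F.

Lemma cop_mul_piR u v :
  \tens_(x, y <- cop (u * piR v)) F x y = \tens_(x, y <- cop u) F x (y * piR v).
Proof.
rewrite copM cop_piR mulrA -copM mulr1 tliftM //; apply: tlift_ext => x y.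
case: bF => Fl Fr.
rewrite tliftk_pure ?mulr1 //.
by split=> ? ? ? ?; rewrite ?linE; [exact: Fl | exact: Fr].
Qed.

Lemma cop_piL_mul u v :
  \tens_(x, y <- cop (piL u * v)) F x y = \tens_(x, y <- cop v) F (piL u * x) y.
Proof. by rewrite cop_piLM tliftMl. Qed.

(** Insert Delta(w) = Delta(w) Delta(1); the weak comultiplicativity of 1 turns
    the two copies of Delta(1) into (Delta (x) id) Delta(1), where the
    counit cancels. *)
Lemma cop_piR_l w :
  \tens_(x, y <- cop w) F (piR x) y = \tens_(x, y <- cop 1) F x (w * y).
Proof.
case: (bF) => Fl Fr.
pose G (x y z : W) : P := \tens_(a, b <- cop w) (counit (a * y) *: F x (b * z)).
have tG : trilin G.
  split=> ? ? ? ? ?; rewrite /G -tlift_lin; apply: tlift_ext => *.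
  - by rewrite Fl scalePr.
  - by rewrite ?linE ?linearP /= ?linE.
  - by rewrite ?linE Fr scalePr.
transitivity (\tens_(x, y <- cop (1 : W)) \tens_(x', y' <- cop (1 : W))
    G x (x' * y) y').
  rewrite -[in LHS](mulr1 w) copM tliftM; last first.
    split=> ? ? ? ?; last exact: Fr.
    rewrite piR_linear; exact: Fl.
  rewrite /G; under [RHS]tlift_ext => x y do rewrite tlift_exchange.
  rewrite [RHS]tlift_exchange; apply: tlift_ext => a b.
  rewrite [RHS]tlift_exchange; apply: tlift_ext => x' y'.
  rewrite /piR (tlift_comp _ _ (Fl _)); apply: tlift_ext => x y.
  by rewrite (scalable_linear (Fl _)) mulrA.
rewrite -cop1r3 // copA3 //; apply: tlift_ext => x y.
rewrite -[w * y in RHS]counitl copM.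
rewrite tliftM; last by split=> ? ? ? ?; rewrite ?linE ?linearP /= ?linE.
rewrite tlift_exchange /G [RHS](tlift_comp _ _ (Fr x)); apply: tlift_ext => a b.
rewrite [RHS](tlift_comp _ _ (Fr x)); apply: tlift_ext => c d.
by rewrite (scalable_linear (Fr x)).
Qed.

(** The mirror image of [cop_piR_l], with Delta(1) inserted on the left. *)
Lemma cop_piL_r w :
  \tens_(x, y <- cop w) F x (piL y) = \tens_(x, y <- cop 1) F (x * w) y.
Proof.
case: (bF) => Fl Fr.
pose G (x y z : W) : P := \tens_(a, b <- cop w) (counit (y * b) *: F (x * a) z).
have tG : trilin G.
  split=> ? ? ? ? ?; rewrite /G -tlift_lin; apply: tlift_ext => *.
  - by rewrite ?linE Fl scalePr.
  - by rewrite ?linE ?linearP /= ?linE.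
  - by rewrite Fr scalePr.
transitivity (\tens_(x, y <- cop (1 : W)) \tens_(x', y' <- cop (1 : W))
    G x (x' * y) y').
  rewrite -[in LHS](mul1r w) copM tliftM; last first.
    by split=> ? ? ? ?; rewrite ?linearP; [exact: Fl | exact: Fr].
  apply: tlift_ext => x y; rewrite [RHS]tlift_exchange; apply: tlift_ext => a b.
  rewrite /piL (tlift_comp _ _ (Fr _)); apply: tlift_ext => x' y'.
  by rewrite (scalable_linear (Fr _)) mulrA.
rewrite -cop1r3 //; apply: tlift_ext => x y.
rewrite -[x * w in RHS]counitr copM.
rewrite tliftM; last by split=> ? ? ? ?; rewrite ?linE ?linearP /= ?linE.
rewrite /G [RHS](tlift_comp _ _ (fun c a b => Fl _ c a b)); apply: tlift_ext => a b.
rewrite [RHS](tlift_comp _ _ (fun c a b => Fl _ c a b)); apply: tlift_ext => c d.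
by rewrite (scalable_linear (Fl _)).
Qed.

Lemma cop_piL_l w :
  \tens_(x, y <- cop w) F (piL x) y = \tens_(x, y <- cop 1) F (piL x) (y * w).
Proof.
have := congr1 (fun t : tensk W W => \tens_(x, y <- t) F x y) (piL_copE w).
rewrite /= !tlift_bind //.
under tlift_ext => x y do rewrite tliftk_pure //.
by under [RHS]tlift_ext => x y do rewrite tliftk_pure //.
Qed.
End WeakBialgebra.

(** * Nondegeneracy of the Haar integral *)

Section HaarIntegral.
Variables (k : fieldType) (W : weakHopfType k) (h : W).
Hypothesis haar_h : haar_integral h.
Implicit Types (a w x y : W).
Local Notation S := (@antipode k W).

Lemma antipode_piL w : \tens_(x, y <- cop w) (S x * piL y) = S w.
Proof.
rewrite -[RHS]antipodeE.
have t3 : trilin (fun x y z => S x * y * S z).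
  by split=> ? ? ? ? ?; rewrite ?linE ?linearP /= ?linE.
rewrite (copA3 t3); apply: tlift_ext => x y.
have ll : linear (fun z => S x * z) by move=> ? ? ?; rewrite linE.
by rewrite -antipoder (tlift_comp _ _ ll); apply: tlift_ext => *; rewrite mulrA.
Qed.

Lemma piR_antipode w : \tens_(x, y <- cop w) (piR x * S y) = S w.
Proof.
rewrite -[RHS]antipodeE; apply: tlift_ext => x y.
have lr : linear (fun z => z * S y) by move=> ? ? ?; rewrite linE.
by rewrite -antipodel (tlift_comp _ _ lr).
Qed.

Section Switch.
Variables (P : lmodType k) (F : W -> W -> P).
Hypothesis bF : bilin F.

(** S(a_1) Delta(a_2 h) can be computed in two ways: a_2 h = Pi^L(a_2) h gives
    the left side, as S(a_1) Pi^L(a_2) = S(a); multiplicativity of Delta gives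
    the right side, as S(a_1) a_2 (x) a_3 = 1_1 (x) a 1_2. *)
Lemma haar_antipodel a :
  \tens_(x, y <- cop h) F (S a * x) y = \tens_(x, y <- cop h) F x (a * y).
Proof.
case: haar_h => hL _ _ _; case: (bF) => Fl Fr.
pose H (a1 a2 a3 : W) := \tens_(x, y <- cop h) F (a1 * a2 * x) (a3 * y).
have tH : trilin H.
  by split=> ? ? ? ? ?; rewrite /H -tlift_lin; apply: tlift_ext => x y;
    rewrite ?linE ?Fl ?Fr.
transitivity (\tens_(a1, a2 <- cop a) \tens_(x, y <- cop (a2 * h)) F (S a1 * x) y).
  under [RHS]tlift_ext => a1 a2.
    rewrite hL cop_piL_mul; last by split=> ? ? ? ?; rewrite ?linE ?Fl ?Fr.
    over.
  rewrite [RHS]tlift_exchange; apply: tlift_ext => x y; rewrite -[in LHS]antipode_piL.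
  have ll : linear (fun z => F (z * x) y) by move=> ? ? ?; rewrite linE Fl.
  by rewrite (tlift_comp _ _ ll); apply: tlift_ext => a1 a2; rewrite mulrA.
transitivity (\tens_(a1, a2 <- cop a) \tens_(b, c <- cop a2) H (S a1) b c).
  apply: tlift_ext => a1 a2; rewrite copM tliftM; last first.
    by split=> ? ? ? ?; rewrite ?linE ?Fl ?Fr.
  by apply: tlift_ext => b c; apply: tlift_ext => x y; rewrite mulrA.
have tH' : trilin (fun a b c => H (S a) b c).
  by case: tH => H1 H2 H3; split=> ? ? ? ? ?; rewrite ?linearP;
    [exact: H1 | exact: H2 | exact: H3].
rewrite -(copA3 tH').
pose K u v := \tens_(x, y <- cop h) F (u * x) (v * y).
have bK : bilin K.
  by split=> ? ? ? ?; rewrite /K -tlift_lin; apply: tlift_ext => x y;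
    rewrite ?linE ?Fl ?Fr.
transitivity (\tens_(q, c <- cop a) K (piR q) c).
  apply: tlift_ext => q c; rewrite -antipodel.
  by rewrite (tlift_comp _ _ (bK.1 c)); apply: tlift_ext => u v.
rewrite (cop_piR_l bK) -[in RHS](mul1r h) copM tliftM; last first.
  by split=> ? ? ? ?; rewrite ?linE ?Fl ?Fr.
by apply: tlift_ext => u v; apply: tlift_ext => x y; rewrite mulrA.
Qed.

(** The same double computation for Delta(h a_1) (1 (x) S(a_2)), now with
    h a_1 = h Pi^R(a_1). *)
Lemma haar_antipoder a :
  \tens_(x, y <- cop h) F (x * a) y = \tens_(x, y <- cop h) F x (y * S a).
Proof.
case: haar_h => _ hR _ _; case: (bF) => Fl Fr.
pose H (a1 a2 a3 : W) := \tens_(x, y <- cop h) F (x * a1) (y * (a2 * S a3)).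
have tH : trilin H.
  by split=> ? ? ? ? ?; rewrite /H -tlift_lin; apply: tlift_ext => x y;
    rewrite ?linearP /= ?linE ?Fl ?Fr.
apply/esym.
transitivity (\tens_(a1, a2 <- cop a) \tens_(x, y <- cop (h * a1)) F x (y * S a2)).
  under [RHS]tlift_ext => a1 a2.
    rewrite hR cop_mul_piR; last by split=> ? ? ? ?; rewrite ?linE ?Fl ?Fr.
    over.
  rewrite [RHS]tlift_exchange; apply: tlift_ext => x y; rewrite -[in LHS]piR_antipode.
  have ll : linear (fun z => F x (y * z)) by move=> ? ? ?; rewrite linE Fr.
  by rewrite (tlift_comp _ _ ll); apply: tlift_ext => a1 a2; rewrite mulrA.
transitivity (\tens_(a1, a2 <- cop a) \tens_(b, c <- cop a1) H b c a2).
  apply: tlift_ext => a1 a2; rewrite copM tliftM; last first.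
    by split=> ? ? ? ?; rewrite ?linE ?Fl ?Fr.
  rewrite tlift_exchange.
  by apply: tlift_ext => b c; apply: tlift_ext => x y; rewrite mulrA.
rewrite (copA3 tH).
pose K u v := \tens_(x, y <- cop h) F (x * u) (y * v).
have bK : bilin K.
  by split=> ? ? ? ?; rewrite /K -tlift_lin; apply: tlift_ext => x y;
    rewrite ?linE ?Fl ?Fr.
transitivity (\tens_(q, c <- cop a) K q (piL c)).
  apply: tlift_ext => q c; rewrite -antipoder.
  by rewrite (tlift_comp _ _ (bK.2 q)); apply: tlift_ext => u v.
rewrite (cop_piL_r bK) -[in RHS](mulr1 h) copM tliftM; last first.
  by split=> ? ? ? ?; rewrite ?linE ?Fl ?Fr.
rewrite [RHS]tlift_exchange.
by apply: tlift_ext => u v; apply: tlift_ext => x y; rewrite mulrA.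
Qed.
End Switch.

Let wdual_of (f : W -> k^o) : linear f -> {F : wdual W | forall w, F w = f w}.
Proof.
move=> lf; pose G := GRing.isLinear.Build _ _ _ _ f lf.
pose f' : {linear W -> k^o} := HB.pack f G.
by exists (linfun f') => w; rewrite lfunE.
Qed.

Let e := vbasis {:W}.
Let c i : {scalar W} := coord e i.
Let coordE x : x = \sum_i c i x *: e`_i.
Proof. exact: coord_vbasis (memvf x). Qed.

(** Expanding S(h_1) h_2 = 1 in a basis (e_i) of W with dual basis (c_i) gives
    1 = sum_i c_i(h_1) S(e_i) h_2 = sum_i c_i(S^2(e_i) h_1) h_2, so lambda is
    the trace form x |-> tr (w |-> S^2(w) x). *)
Lemma haar_dual_ex :
  exists lambda : wdual W, \tens_(x, y <- cop h) (lambda x *: y) = 1.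
Proof.
pose lam (x : W) : k^o := \sum_i c i (S (S e`_i) * x).
have llam : linear lam.
  move=> d x y; rewrite /lam scaler_sumr -big_split; apply: eq_bigr => i _.
  by rewrite linE linearP.
have [lambda lambdaE] := wdual_of llam; exists lambda.
transitivity (\sum_i \tens_(x, y <- cop h) (c i (S (S e`_i) * x) *: y)).
  rewrite exchange_big; apply: eq_bigr => p _.
  by rewrite lambdaE scaler_suml.
under eq_bigr => i _.
  rewrite (@haar_antipodel _ (fun x y => c i x *: y)); last first.
    by split=> ? ? ? ?; rewrite ?linearP /= ?linE.
  over.
case: haar_h => _ _ _ <-; rewrite -antipodel exchange_big.
apply: eq_bigr => p _; rewrite [in RHS](coordE p.1) linear_sum mulr_suml.
by apply: eq_bigr => i _; rewrite linearZ /= scalerAl.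
Qed.

(** Dually, w = h_1 S(h_2) w = sum_i c_i(h_2) h_1 S(e_i) w, and
    [haar_antipoder] moves S(e_i) w into the argument of c_i. *)
Lemma haar_span w :
  exists f : wdual W, \tens_(x, y <- cop h) (f y *: x) = w.
Proof.
pose f (y : W) : k^o := \sum_i c i (y * S (S e`_i * w)).
have lf : linear f.
  move=> d x y; rewrite /f scaler_sumr -big_split; apply: eq_bigr => i _.
  by rewrite linE linearP.
have [f' f'E] := wdual_of lf; exists f'.
transitivity (\sum_i \tens_(x, y <- cop h) (c i (y * S (S e`_i * w)) *: x)).
  rewrite exchange_big; apply: eq_bigr => p _.
  by rewrite f'E scaler_suml.
under eq_bigr => i _.
  rewrite -(@haar_antipoder _ (fun x y => c i y *: x)); last first.
    by split=> ? ? ? ?; rewrite ?linearP /= ?linE.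
  over.
rewrite -[RHS]mul1r; case: haar_h => _ _ <- _; rewrite -antipoder exchange_big.
rewrite /tlift mulr_suml; apply: eq_bigr => p _.
rewrite [in RHS](coordE p.2) linear_sum mulr_sumr mulr_suml.
by apply: eq_bigr => i _; rewrite linearZ /= -scalerAr -scalerAl mulrA.
Qed.

(** With lambda(h_1) h_2 = 1, a = lambda(h_1) a h_2 = lambda(S(a) h_1) h_2, so S
    is injective, hence onto since W is finite dimensional. *)
Lemma antipode_surj w : exists v, S v = w.
Proof.
have [lambda lamE] := haar_dual_ex.
have S_inj : injective (linfun S).
  move=> a b; rewrite !lfunE /= => Sab; apply/eqP; rewrite -subr_eq0; apply/eqP.
  rewrite -[LHS]mulr1 -lamE (tlift_comp _ _ (fun d x y => mulPr d (a - b) x y)).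
  transitivity (\tens_(x, y <- cop h) (lambda x *: ((a - b) * y))).
    by apply: tlift_ext => x y; rewrite -scalerAr.
  rewrite -(@haar_antipodel W (fun x y => (lambda x : k) *: y)); last first.
    by split=> ? ? ? ?; rewrite ?linearP /= ?linE.
  rewrite linearB Sab subrr /= /tlift big1 // => p _.
  by rewrite mul0r linear0 scale0r.
exists ((linfun S)^-1%VF w); rewrite -[LHS]lfunE.
exact: (lker0_lfunVK (introT lker0P S_inj)).
Qed.
End HaarIntegral.

(** * Dual bases of finite projective modules *)

Section DualBasis.
Variables (R : pzRingType) (M : lmodType R).

Definition has_dual_basis : Prop :=
  exists n (g : 'I_n -> M) (c : 'I_n -> M -> R),
    (forall i, linear (c i : M -> R^o)) /\
    forall x, \sum_(i < n) c i x *: g i = x.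

Lemma dual_basisP : finite_projective M <-> has_dual_basis.
Proof.
split=> [[[n [g gM]] prM]|[n [g [c [lc cE]]]]].
  pose p (v : {ffun 'I_n -> R^o}) : M := \sum_(i < n) (v i : R) *: g i.
  have lp : linear p.
    move=> a u v; rewrite /p scaler_sumr -big_split; apply: eq_bigr => i _.
    by rewrite /= !ffunE scalerDl scalerA.
  pose G := GRing.isLinear.Build _ _ _ _ p lp.
  have [|q qK] := prM _ _ (HB.pack p G : {linear _ -> _}) idfun.
    move=> x; have [c cE] := gM x; exists [ffun i => c i].
    by rewrite [RHS]cE; apply: eq_bigr => i _; rewrite ffunE.
  exists n, g, (fun i x => q x i); split=> [i a x y|x].
    by rewrite linearP !ffunE.
  exact: qK.
split; first by exists n, g => x; exists (c^~ x); rewrite cE.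
move=> P Q p f p_surj.
have [y yE] := choice (fun i => p_surj (f (g i))).
pose q x := \sum_(i < n) c i x *: y i.
have lq : linear q.
  move=> a u v; rewrite /q scaler_sumr -big_split; apply: eq_bigr => i _.
  by rewrite lc scalerDl scalerA.
pose G := GRing.isLinear.Build _ _ _ _ q lq.
exists (HB.pack q G : {linear _ -> _}) => x.
rewrite -[in RHS](cE x) [in LHS]/= /q !linear_sum; apply: eq_bigr => i _.
by rewrite !linearZ yE.
Qed.
End DualBasis.

(** * Tensors as linear maps on the weak bialgebra *)

Section Evaluation.
Variables (k : fieldType) (W : weakBialgType k) (A : algType k).
Implicit Types (s t : tensk A (wdual W)) (w : W).

Definition teval t w : A := \tens_(x, f <- t) (dpair f w *: x).

Lemma teval_bilin w : bilin (fun (x : A) (f : wdual W) => dpair f w *: x).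
Proof.
split=> [f e x x'|x e f f']; first by rewrite linE.
by rewrite /dpair add_lfunE scale_lfunE scalePl.
Qed.

Lemma teval_linearl w : linear (teval^~ w).
Proof. exact/tliftk_linear/teval_bilin. Qed.

Lemma teval_linearr t : linear (teval t).
Proof.
move=> e w v; rewrite /teval -tlift_lin; apply: tlift_ext => x f.
by rewrite /dpair linearP scalePl.
Qed.

Lemma teval_ox x f w : teval (x \ox f) w = dpair f w *: x.
Proof. exact/tliftk_pure/teval_bilin. Qed.

Lemma teval_inj s t : teval s =1 teval t -> s = t.
Proof.
pose e := vbasis {:W}; pose d i : wdual W := linfun (coord e i : W -> k^o).
have dE (f : wdual W) : f = \sum_(i < \dim {:W}) f e`_i *: d i.
  apply/lfunP => w; rewrite sum_lfunE [in LHS](coord_vbasis (memvf w)) linear_sum.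
  by apply: eq_bigr => i _; rewrite linearZ scale_lfunE lfunE; exact: mulrC.
suffices tE u : u = \sum_(i < \dim {:W}) teval u e`_i \ox d i.
  by move=> st; rewrite (tE s) (tE t); apply: eq_bigr => i _; rewrite st.
transitivity (\tens_(x, f <- u) \sum_(i < \dim {:W}) (dpair f e`_i *: x) \ox d i).
  rewrite -[LHS]tlift_ox; apply: tlift_ext => x f.
  have lx : linear (fun f : wdual W => x \ox f) by move=> ? ? ?; rewrite linE.
  rewrite [in LHS](dE f) (lin_sum lx); apply: eq_bigr => i _.
  by rewrite oxZl oxZr.
rewrite /tlift exchange_big; apply: eq_bigr => i _ /=.
have ld : linear (fun y : A => y \ox d i) by move=> ? ? ?; rewrite linE.
by rewrite [RHS](tlift_comp _ _ ld).
Qed.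

(** The algebra W^* carries the convolution product. *)
Lemma tevalM s t w :
  teval (s * t) w = \tens_(u, v <- cop w) (teval s u * teval t v).
Proof.
rewrite [LHS]tliftM; last exact: teval_bilin.
rewrite /teval /tlift; under [RHS]eq_bigr => p _.
  rewrite mulr_suml; under eq_bigr => q _ do rewrite mulr_sumr.
  over.
rewrite [RHS]exchange_big; apply: eq_bigr => p _.
rewrite [RHS]exchange_big; apply: eq_bigr => q _.
rewrite /dpair [(_ * _ : wdual W) w]convE scaler_suml; apply: eq_bigr => r _.
by rewrite -scalerAl -scalerAr scalerA.
Qed.
End Evaluation.

(** * The smash product and its action *)

Section SmashFacts.
Variables (k : fieldType) (W : weakBialgType k) (A : moduleAlgType W).
Implicit Types (a b x y : A) (u v w : W) (s t : smash A).

Lemma spureM a w b v :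
  spure a w * spure b v =
  \tens_(x, y <- cop w) spure (a * act x b) (y * v) :> smash A.
Proof. exact: smash_mul_pure. Qed.

Lemma smash_actr s : linear (smash_act s).
Proof.
move=> e x y; rewrite /smash_act -tlift_lin; apply: tlift_ext => a w.
by rewrite ?(slinE A).
Qed.

Lemma smash_actM s t x : smash_act (s * t) x = smash_act s (smash_act t x).
Proof.
rewrite [s * t]/(smash_mul s t) [LHS](tlift_comp _ _ (smash_act_linear x)).
apply: tlift_ext => a w; rewrite (tlift_comp _ _ (smash_act_linear x)).
have la : linear (fun z => a * act w z) by move=> ? ? ?; rewrite ?(slinE A).
rewrite [RHS](tlift_comp _ _ la); apply: tlift_ext => b v.
rewrite (tlift_comp _ _ (smash_act_linear x)) act_mul.
have ll : linear (fun z => a * z) by move=> ? ? ?; rewrite linE.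
rewrite [RHS](tlift_comp _ _ ll); apply: tlift_ext => u u'.
by rewrite smash_act_pure actM mulrA.
Qed.

Lemma smash_act1 x : smash_act (1 : smash A) x = x.
Proof. by rewrite smash_act_pure mul1r act1. Qed.

Lemma smash_act_invr s x b :
  Defs.invariant b -> smash_act s (x * b) = smash_act s x * b.
Proof.
move=> bI; rewrite /smash_act /tlift mulr_suml; apply: eq_bigr => p _.
by rewrite act_mul_inv // mulrA.
Qed.

(** This is s applied to 1 (x) 1 in A (x) W, on which a # w acts by
    x (x) v |-> a (w_1.x) (x) w_2 v.  It replaces elements of A (x)_(W^L) W by
    elements of A (x) W, to which functionals on W can be applied. *)
Definition smash_emb s : tensk A W :=
  \tens_(a, w <- s) \tens_(u, v <- cop w) ((a * act u 1) \ox v).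

Lemma smash_emb_balanced :
  balanced (fun (z : subvs_of (WL W)) a => a * act (vsval z) 1)
    (fun z w => vsval z * w)
    (fun a w => \tens_(u, v <- cop w) ((a * act u 1) \ox v) : tensk A W).
Proof.
have bi a : bilin (fun u v : W => (a * act u 1) \ox v : tensk A W).
  by split=> ? ? ? ?; rewrite ?(slinE A).
split=> [w e a a'|a e w w'|z a w].
- by rewrite -tlift_lin; apply: tlift_ext => u v; rewrite ?(slinE A).
- by rewrite linearP; exact/tliftk_linear/bi.
have [u ->] := WL_P z; rewrite cop_piL_mul //; apply: tlift_ext => x y.
by rewrite actM [in RHS]act_piL mulrA.
Qed.

Lemma smash_emb_linear : linear smash_emb.
Proof. exact/tlift_linear/smash_emb_balanced. Qed.

Lemma smash_emb_pure a w :
  smash_emb (spure a w) = \tens_(u, v <- cop w) ((a * act u 1) \ox v).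
Proof. exact/tlift_pure/smash_emb_balanced. Qed.
End SmashFacts.

(** * The Galois map as a map of functions *)

Section Coaction.
Variables (k : fieldType) (W : weakBialgType k) (A : moduleAlgType W).
Variable rho : {linear A -> tensk A (wdual W)}.
Hypothesis rhoE : is_coaction rho.
Implicit Types (x y : A) (w : W).

Lemma teval_rho x w : teval (rho x) w = act w x.
Proof. by rewrite rhoE. Qed.

Lemma teval_galois t w :
  teval (galois_map rho t) w = \tens_(x, y <- t) (x * act w y).
Proof.
rewrite (tlift_comp _ _ (teval_linearl w)); apply: tlift_ext => x y.
rewrite (tlift_comp _ _ (teval_linearl w)) rhoE /tlift mulr_sumr.
by apply: eq_bigr => p _; rewrite teval_ox scalerAr.
Qed.

Lemma teval_mul_rho1 t w :
  teval (t * rho 1) w = \tens_(u, v <- cop w) (teval t u * act v 1).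
Proof. by rewrite tevalM; apply: tlift_ext => u v; rewrite teval_rho. Qed.

(** rho(x) = rho(x 1) and rho is multiplicative.  In particular rho(1) is
    idempotent, which is what [left_ideal_rho1] rests on. *)
Lemma rho_mul1 x : rho x * rho 1 = rho x.
Proof.
apply: teval_inj => w; rewrite teval_mul_rho1 teval_rho -[x in RHS]mulr1 act_mul.
by apply: tlift_ext => u v; rewrite teval_rho.
Qed.

Lemma left_ideal_rho1 t : left_ideal_gen (rho 1) t <-> t * rho 1 = t.
Proof. by split=> [[s ->]|<-]; [rewrite -mulrA rho_mul1 | exists t]. Qed.

Lemma galois_map_mul_rho1 t : galois_map rho t * rho 1 = galois_map rho t.
Proof.
apply: teval_inj => w; rewrite teval_mul_rho1 teval_galois.
under tlift_ext => u v do rewrite teval_galois /tlift mulr_suml.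
rewrite /tlift exchange_big; apply: eq_bigr => p _.
rewrite -[p.2 in RHS]mulr1 act_mul /tlift mulr_sumr.
by apply: eq_bigr => q _; rewrite mulrA.
Qed.
End Coaction.

(** * The trace and the Morita pairing *)

Section Trace.
Variables (k : fieldType) (W : weakBialgType k) (A : moduleAlgType W) (h : W).
Hypothesis haar_h : haar_integral h.
Implicit Types (a b x y : A) (w : W) (s : smash A).

Lemma haar_act_invariant a : Defs.invariant (act h a).
Proof. by case: haar_h => hL _ _ _ w; rewrite -!actM hL. Qed.

Lemma haar_act_id b : Defs.invariant b -> act h b = b.
Proof. by case: haar_h => _ _ hL1 _ ->; rewrite hL1 act1. Qed.

Definition trace a : invariants A :=
  Invariants (introT (inv_predP _) (haar_act_invariant a)).

(** For s = a # w the left side is a (w_1.x) # w_2 h; as w_2 h = Pi^L(w_2) h, the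
    factor Pi^L(w_2) moves to the left leg, where it acts as w_2.1. *)
Lemma smash_mul_haar s x : s * spure x h = spure (smash_act s x) h.
Proof.
have lh : linear (fun y : A => spure y h : smash A).
  by move=> ? ? ?; rewrite ?(slinE A).
rewrite (tlift_comp _ _ lh) -[in LHS](tlift_tpure s).
rewrite [LHS](tlift_comp _ _ (smash_mul_linearl (spure x h))).
apply: tlift_ext => a w; rewrite [LHS]spureM -[x in RHS]mulr1 act_mul.
have la : linear (fun z => spure (a * z) h : smash A).
  by move=> ? ? ?; rewrite ?(slinE A).
rewrite [RHS](tlift_comp _ _ la); apply: tlift_ext => u v.
by case: haar_h => hL _ _ _; rewrite hL -spure_piL -act_one mulrA.
Qed.

(** The pairing A (x)_B A -> A # W of the Morita context, evaluated on a
    formal sum of pairs. *)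
Definition morita (r : seq (A * A)) : smash A :=
  \sum_(p <- r) spure p.1 h * spure p.2 1.

Lemma moritaE r :
  morita r = \tens_(u, v <- cop h) spure (\sum_(p <- r) p.1 * act u p.2) v.
Proof.
rewrite /tlift; under [RHS]eq_bigr => q _.
  have lq : linear (fun y : A => spure y q.2 : smash A).
    by move=> ? ? ?; rewrite ?(slinE A).
  rewrite (lin_sum lq); over.
rewrite exchange_big; apply: eq_bigr => p _.
by rewrite spureM; apply: eq_bigr => q _; rewrite mulr1.
Qed.

Lemma smash_act_morita r a :
  smash_act (morita r) a = \sum_(p <- r) p.1 * act h (p.2 * a).
Proof.
rewrite (lin_sum (smash_act_linear a)); apply: eq_bigr => p _.
by rewrite smash_actM !smash_act_pure act1.
Qed.
End Trace.

(** * Full families *)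

Section HaarFullness.
Variables (k : fieldType) (W : weakHopfType k) (h : W).
Hypothesis haar_h : haar_integral h.
Variable A : moduleAlgType W.
Implicit Types (a b x y : A) (w : W).
Local Notation S := (@antipode k W).

Definition haar_full : Prop := exists r : seq (A * A), morita h r = 1.

Lemma sum_act_linear (r : seq (A * A)) :
  linear (fun w => \sum_(p <- r) p.1 * act w p.2).
Proof.
move=> e u v; rewrite scaler_sumr -big_split; apply: eq_bigr => p _.
by rewrite ?(slinE A).
Qed.

(** The right side is (w_1.x)(w_2 S(w_3).y) = (w_1.x)(w_2.1) y. *)
Lemma act_mul_antipode w x y :
  act w x * y = \tens_(u, v <- cop w) act u (x * act (S v) y).
Proof.
pose F (u v z : W) := act u x * act (v * S z) y.
have tF : trilin F by split=> ? ? ? ? ?; rewrite /F ?linearP /= ?(slinE A).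
transitivity (\tens_(u, v <- cop w) \tens_(u1, u2 <- cop u) F u1 u2 v); last first.
  apply: tlift_ext => u v; rewrite act_mul; apply: tlift_ext => u1 u2.
  by rewrite /F actM.
rewrite copA3 // -[x in LHS]mulr1 act_mul /tlift mulr_suml; apply: eq_bigr => p _.
have ll : linear (fun z : W => act p.1 x * act z y) by move=> ? ? ?; rewrite ?(slinE A).
rewrite -[RHS](tlift_comp (fun v z => v * S z) (cop p.2) ll) antipoder.
by rewrite act_piL -act_one mulrA.
Qed.

Section Galois.
Variable rho : {linear A -> tensk A (wdual W)}.
Hypothesis rhoE : is_coaction rho.

(** A preimage of (1 (x) lambda) rho(1) is full:
    sum_i x_i (h_1.y_i) # h_2 = lambda(h_1)(h_2.1) # h_3
    = 1 # lambda(h_1) Pi^L(h_2) h_3 = 1 # lambda(h_1) h_2 = 1 # 1. *)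
Lemma galois_surj_full :
  (forall t, left_ideal_gen (rho 1) t -> exists u, galois_map rho u = t) ->
  haar_full.
Proof.
move=> beta_surj; have [lambda lambdaE] := haar_dual_ex haar_h.
have [|r rE] := beta_surj ((1 \ox lambda) * rho 1); first by exists (1 \ox lambda).
(* The sums over the tensor r run over this family of pairs. *)
exists (repr r); rewrite (moritaE h).
have phiE u : \sum_(p <- repr r) p.1 * act u p.2 =
    \tens_(u1, u2 <- cop u) ((lambda u1 : k) *: act u2 (1 : A)).
  rewrite -[LHS](teval_galois rhoE r u) rE (teval_mul_rho1 rhoE).
  by apply: tlift_ext => u1 u2; rewrite teval_ox -scalerAl mul1r.
pose F (u1 u2 v : W) : smash A := (lambda u1 : k) *: spure (act u2 1) v.
have tF : trilin F.
  by split=> ? ? ? ? ?; rewrite /F ?linearP /= ?(slinE A).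
transitivity (\tens_(u, v <- cop h) \tens_(u1, u2 <- cop u) F u1 u2 v).
  apply: tlift_ext => u v; rewrite phiE.
  have ls : linear (fun y : A => spure y v : smash A).
    by move=> ? ? ?; rewrite ?(slinE A).
  rewrite (tlift_comp _ _ ls); apply: tlift_ext => u1 u2.
  by rewrite /F (scalable_linear ls).
rewrite copA3 //.
have ls : linear (fun v : W => spure 1 v : smash A).
  by move=> ? ? ?; rewrite ?(slinE A).
transitivity (\tens_(u, v <- cop h) (spure 1 ((lambda u : k) *: v) : smash A)).
  apply: tlift_ext => u v.
  rewrite (scalable_linear ls) -[v in RHS]piL_cop (tlift_comp _ _ ls) /= /tlift.
  rewrite scaler_sumr; apply: eq_bigr => p _.
  by rewrite /F -spure_piL mul1r -act_one.
by rewrite -(tlift_comp _ _ ls) lambdaE.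
Qed.

(** In the image of a full family under [smash_emb] the factor h_2.1 is absorbed
    by (h_1.y_i)(h_2.1) = h_1.y_i; so the identity defining fullness, which holds
    modulo W^L, lifts to one in A (x) W. *)
Lemma full_morita_emb r : morita h r = 1 :> smash A ->
  \tens_(u, v <- cop h) ((\sum_(p <- r) p.1 * act u p.2) \ox v) =
  \tens_(u, v <- cop 1) (act u 1 \ox v) :> tensk A W.
Proof.
move=> /(congr1 (@smash_emb k W A)); rewrite (smash_emb_pure 1 1) moritaE.
under [RHS]tlift_ext => u v do rewrite mul1r.
move=> <-; rewrite (tlift_comp _ _ (@smash_emb_linear k W A)).
pose phi u := \sum_(p <- r) p.1 * act u p.2.
have lphi : linear phi := sum_act_linear r.
pose F (u v z : W) : tensk A W := (phi u * act v 1) \ox z.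
have tF : trilin F by split=> ? ? ? ? ?; rewrite /F ?lphi ?(slinE A).
transitivity (\tens_(u, v <- cop h) \tens_(u1, u2 <- cop u) F u1 u2 v); last first.
  by rewrite copA3 //; apply: tlift_ext => u v; rewrite smash_emb_pure.
apply: tlift_ext => u v.
have lv : linear (fun y : A => y \ox v) by move=> ? ? ?; rewrite linE.
rewrite -[RHS](tlift_comp (fun u1 u2 => phi u1 * act u2 1) (cop u) lv).
congr (_ \ox _); rewrite /tlift.
under [RHS]eq_bigr => q _ do rewrite /phi mulr_suml.
rewrite exchange_big; apply: eq_bigr => p _.
rewrite -[p.2 in LHS]mulr1 act_mul /tlift mulr_sumr.
by apply: eq_bigr => q _; rewrite mulrA.
Qed.

Lemma full_trace r a : morita h r = 1 :> smash A ->
  \sum_(p <- r) p.1 * act h (p.2 * a) = a.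
Proof. by move=> rE; rewrite -smash_act_morita rE smash_act1. Qed.

(** Through the dual basis, a tensor over B is determined by the elements
    sum_j (h.(y_i a_j)) b_j.  By [act_mul_antipode] they equal
    sum_j h_1.(y_i a_j (S(h_2).b_j)), which only depends on the values
    sum_j a_j (w.b_j) of the Galois map. *)
Lemma full_galois_inj : haar_full -> injective (galois_map rho).
Proof.
case=> r rE.
have lbeta := galois_map_linear rhoE.
suffices ker t : galois_map rho t = 0 -> t = 0.
  move=> s t /eqP; rewrite -subr_eq0 -(zmod_morphism_linear lbeta) => /eqP /ker.
  by move/eqP; rewrite subr_eq0 => /eqP.
move=> t0.
have evt w : \tens_(x, y <- t) (x * act w y) = 0.
  by rewrite -(teval_galois rhoE) t0 (lin0 (teval_linearl w)).
have trt (z : A) : \tens_(x, y <- t) (act h (z * x) * y) = 0.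
  under tlift_ext => x y do rewrite act_mul_antipode.
  rewrite tlift_exchange; apply: big1 => q _.
  have lq : linear (fun y => act q.1 (z * y)) by move=> ? ? ?; rewrite ?(slinE A).
  under tlift_ext => x y do rewrite -mulrA.
  rewrite -(tlift_comp (fun x y => x * act (S q.2) y) t lq) evt mulr0.
  exact: lin0 (act_linearr q.1).
pose B1 (b : invariants A) x := x * inv_val b.
pose B2 (b : invariants A) x := inv_val b * x.
have tl y : linear (fun x => tpure B1 B2 x y).
  by case: (balanced_pure B1 B2) => + _ _; apply.
have tr x : linear (tpure B1 B2 x) by case: (balanced_pure B1 B2).
rewrite -[LHS]tlift_tpure.
transitivity (\tens_(x, y <- t) \sum_(p <- r)
    tpure B1 B2 p.1 (act h (p.2 * x) * y)).
  apply: tlift_ext => x y; rewrite -[x in LHS](full_trace x rE) (lin_sum (tl y)).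
  apply: eq_bigr => p _.
  exact: (tpure_bal B1 B2 (trace haar_h (p.2 * x)) p.1 y).
rewrite /tlift exchange_big; apply: big1 => p _.
rewrite -[LHS](tlift_comp (fun x y => act h (p.2 * x) * y) t (tr p.1)) trt.
exact: lin0 (tr p.1).
Qed.

(** The preimage of g is sum_i g(h_1) x_i (x) T(h_2).y_i, where T is a section of
    the antipode.  To evaluate it, write the argument as w = h'_1 f(h'_2):
    [haar_antipoder] moves T(h_2) to the right of h'_2, where it becomes h_2, and
    then fullness of the family leaves g(h_1)(h_2.1) f(h_3) = g(w). *)
Lemma full_galois_surj t : haar_full -> t * rho 1 = t ->
  exists u, galois_map rho u = t.
Proof.
case=> r rE tE; pose g := teval t.
have lg : linear g := teval_linearr t.
have gE w : g w = \tens_(u, v <- cop w) (g u * act v 1).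
  by rewrite -(teval_mul_rho1 rhoE) tE.
have [T TK] := choice (antipode_surj haar_h).
pose phi u := \sum_(p <- r) p.1 * act u p.2.
have lphi : linear phi := sum_act_linear r.
have lbeta : linear (galois_map rho) := galois_map_linear rhoE.
pose pure x y : tensB A := tpure _ _ x y.
have phiM (f : wdual W) (y : W) :
    \tens_(x', y' <- cop h) ((f y' : k) *: phi (x' * T y)) =
    \tens_(u, v <- cop 1) ((f (v * y) : k) *: act u 1).
  rewrite (haar_antipoder haar_h (F := fun u v : W => (f v : k) *: phi u)).
    2: by split=> ? ? ? ?; rewrite ?lphi ?linearP /= ?linE.
  have bG : bilin (fun (a : A) v => (f (v * y) : k) *: a).
    by split=> ? ? ? ?; rewrite ?linE ?linearP /= ?linE.
  have := congr1 (fun t : tensk A W => \tens_(a, v <- t) ((f (v * y) : k) *: a))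
    (full_morita_emb rE).
  rewrite /= !tlift_bind //; under tlift_ext => u v do rewrite tliftk_pure //.
  under [in X in _ = X -> _]tlift_ext => u v do rewrite tliftk_pure //.
  by rewrite TK.
exists (\tens_(x, y <- cop h) \sum_(p <- r) pure (g x * p.1) (act (T y) p.2)).
apply: teval_inj => w; have [f wE] := haar_span haar_h w.
have lev : linear (fun s : tensB A => teval (galois_map rho s) w).
  by move=> ? ? ?; rewrite lbeta teval_linearl.
rewrite (tlift_comp _ _ lev).
transitivity (\tens_(x, y <- cop h) (g x * \tens_(u, v <- cop 1)
    ((f (v * y) : k) *: act u 1))).
  apply: tlift_ext => x y; rewrite (lin_sum lev) -phiM.
  transitivity (g x * phi (w * T y)).
    rewrite /phi mulr_sumr; apply: eq_bigr => p _.
    rewrite teval_galois // tlift_pure; last first.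
      split=> [? ? ? ?|? ? ? ?|b ? ?]; rewrite ?(slinE A) //.
      by rewrite act_inv_mul ?mulrA //; exact/inv_predP/inv_valP.
    by rewrite actM mulrA.
  have lT : linear (fun z => phi (z * T y)) by move=> ? ? ?; rewrite linE lphi.
  rewrite -wE (tlift_comp _ _ lT); congr (_ * _); apply: tlift_ext => u v.
  by rewrite (scalable_linear lT).
(* It remains to see that g(h_1)(1_1.1) f(1_2 h_2) = g(h_1)(h_2.1) f(h_3). *)
pose F (u v z : W) := (f z : k) *: (g u * act v 1).
have tF : trilin F.
  by split=> ? ? ? ? ?; rewrite /F ?lg ?linearP /= ?(slinE A).
transitivity (\tens_(x, y <- cop h) \tens_(y1, y2 <- cop y) F x y1 y2).
  apply: tlift_ext => x y.
  have bF : bilin (F x).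
    by case: tF => F1 F2 F3; split=> ? ? ? ?; [exact: F2 | exact: F3].
  transitivity (\tens_(u, v <- cop 1) F x (piL u) (v * y)).
    rewrite /tlift mulr_sumr; apply: eq_bigr => p _.
    by rewrite /F -act_one scalerAr.
  rewrite -(cop_piL_l bF); apply: tlift_ext => y1 y2.
  by rewrite /F -act_one.
rewrite -copA3 // -/(g w) -wE (tlift_comp _ _ lg); apply: tlift_ext => x y.
rewrite (scalable_linear lg) [in RHS]gE /= /tlift scaler_sumr.
by apply: eq_bigr => p _.
Qed.

Lemma full_galois_iso : haar_full ->
  linear_iso_onto (galois_map rho) (left_ideal_gen (rho 1)).
Proof.
move=> full; split; [exact: galois_map_linear|exact: full_galois_inj|].
move=> t; rewrite (left_ideal_rho1 rhoE); split; first exact: full_galois_surj.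
by case=> u <-; exact: galois_map_mul_rho1.
Qed.
End Galois.

(** For s = b # w write w = S(v): then
    h.(b (S(v).a)) = (h_1.b)(h_2 S(v).a) = (h_1 v.b)(h_2.a) = h.((v.b) a). *)
Lemma haar_smash_act s :
  exists y, forall a, act h (smash_act s a) = act h (y * a).
Proof.
elim/tens_ind: s => [|b w|s s' [y yE] [y' y'E]].
- exists 0 => a; rewrite mul0r; congr act.
  exact: lin0 (smash_act_linear a).
- have [v <-] := antipode_surj haar_h w; exists (act v b) => a.
  rewrite smash_act_pure !act_mul.
  have bF : bilin (fun x y : W => act x b * act y a).
    by split=> ? ? ? ?; rewrite ?(slinE A).
  transitivity (\tens_(x, y <- cop h) (act x b * act (y * S v) a)).
    by apply: tlift_ext => x y; rewrite actM.
  rewrite -(haar_antipoder haar_h (F := fun x y : W => act x b * act y a)) //.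
  by apply: tlift_ext => x y; rewrite actM.
exists (y + y') => a; rewrite (linD (smash_act_linear a)) mulrDl.
by rewrite !(linD (act_linearr h)) yE y'E.
Qed.

(** The coordinate functions of a dual basis are endomorphisms of A with values
    in B; they come from A # W, hence from h # W by invariance. *)
Lemma iso_full : smash_act_iso A -> finite_projective (rightB A) -> haar_full.
Proof.
case=> _ _ _ act_inj act_surj /dual_basisP[n [g [c [lc cE]]]].
have smash_c i : exists y, forall a, act h (y * a) = inv_val (c i a).
  have [|s sE] := (act_surj (fun a => inv_val (c i a))).1.
    by move=> b x y; rewrite lc.
  have [y yE] := haar_smash_act s; exists y => a.
  by rewrite -yE sE (haar_act_id haar_h) //; exact/inv_predP/inv_valP.
have [y yE] := choice smash_c.
exists [seq (g i : A, y i) | i <- enum 'I_n]; apply: act_inj.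
apply: funext => a; rewrite smash_act_morita smash_act1 big_map big_enum /=.
by rewrite -[RHS]cE; apply: eq_bigr => i _; rewrite yE.
Qed.

(** For a full family, s = sum_i (pi(s)(x_i) # h)(y_i # 1) by [smash_mul_haar].
    This gives injectivity and prescribes the preimage of a B-linear map. *)
Lemma full_iso : haar_full -> smash_act_iso A.
Proof.
case=> r rE; split.
- exact: smash_act_linear.
- by apply: funext => x; rewrite smash_act1.
- by move=> s t; apply: funext => x; exact: smash_actM.
- move=> s t st; rewrite -[s]mulr1 -[t]mulr1 -rE !mulr_sumr.
  by apply: eq_bigr => p _; rewrite !mulrA !(smash_mul_haar haar_h) st.
move=> f; split=> [lf|[s <-] b x y]; last first.
  rewrite -[b *: x]/(x * inv_val b).
  by rewrite (linD (smash_actr s)) smash_act_invr //; exact/inv_predP/inv_valP.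
exists (\sum_(p <- r) spure (f p.1) h * spure p.2 1); apply: funext => a.
rewrite (lin_sum (smash_act_linear a)) -[in RHS](full_trace a rE).
have f_sum (F : A * A -> A) : f (\sum_(p <- r) F p) = \sum_(p <- r) f (F p).
  pose G := GRing.isLinear.Build _ _ _ _ (f : rightB A -> rightB A) lf.
  exact: (raddf_sum (HB.pack (f : rightB A -> rightB A) G : {linear _ -> _})).
rewrite f_sum; apply: eq_bigr => p _; rewrite smash_actM !smash_act_pure act1.
exact/esym/(scalable_linear lf (trace haar_h (p.2 * a)) p.1).
Qed.

Lemma full_finite_projective : haar_full -> finite_projective (rightB A).
Proof.
case=> r rE; apply/dual_basisP.
exists (size r), (fun i => (tnth (in_tuple r) i).1 : rightB A).
exists (fun i a => trace haar_h ((tnth (in_tuple r) i).2 * a)); split.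
  move=> i b x y; apply: val_inj => /=.
  set z := (tnth _ _).2; rewrite -[b *: x]/(x * inv_val b) mulrDr.
  by rewrite (linD (act_linearr h)) mulrA act_mul_inv //; exact/inv_predP/inv_valP.
by move=> x; rewrite -[RHS](full_trace x rE) [in RHS]big_tnth.
Qed.
End HaarFullness.

Theorem theorem4p2 (k : closedFieldType) (char0 : [pchar k] =i pred0)
    (W : weakHopfType k) (ssW : semisimple_alg W)
    (h : W) (haar_h : haar_integral h)
    (A : moduleAlgType W)
    (rho : {linear A -> tensk A (wdual W)}) (rhoE : is_coaction rho) :
  linear_iso_onto (galois_map rho) (left_ideal_gen (rho 1)) <->
  smash_act_iso A /\ finite_projective (rightB A).
Proof.
split=> [[_ _ onto]|[iso fp]].
  have full : haar_full h A by apply: (galois_surj_full haar_h rhoE) => t /onto.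
  by split; [exact: (full_iso haar_h) | exact: (full_finite_projective haar_h)].
by apply: (full_galois_iso haar_h rhoE); exact: (iso_full haar_h).
Qed.
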